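(* Let $x : M \rightarrow \mathbb{E}^{4}$ be a connected hypersurface of $\mathbb{E}^4$ (isometrically immersed, $\dim M=3$). Then the Laplace transformation $\mathcal{L} : M \rightarrow L(M)$ of the hypersurface is homothetic if and only if $M$ is an open portion of a hypersphere of $\mathbb{E}^4$.
   Context: Manifolds and immersions are smooth and connected. $\Delta=-\operatorname{trace}\nabla^2$ is the Laplace operator of $M$ with the induced metric. The Laplace map is $L:M\to\mathbb{E}^4$, $L(p)=(\Delta x)(p)$, equal to $-3H(p)$ where $H=\frac13\operatorname{trace}h$ is the mean curvature vector; the Laplace transformation $\mathcal L:M\to L(M)$ is $L$ regarded as a map onto its image. $\mathcal L$ is homothetic if there is a constant $c>0$ with $\langle dL(X),dL(Y)\rangle=c^2\langle X,Y\rangle$ for all tangent vectors $X,Y$ at a common point. The hypersphere may have any center and radius. *)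

(* Defs.v *)
From HB Require Import structures.
From mathcomp Require Import all_boot all_order all_algebra.
From mathcomp Require Import all_classical all_reals all_analysis.

Set Implicit Arguments.
Unset Strict Implicit.
Unset Printing Implicit Defensive.

Import Order.TTheory GRing.Theory Num.Theory.
Import numFieldNormedType.Exports.

Local Open Scope classical_set_scope.
Local Open Scope ring_scope.

(* Row vectors carry the sup norm in the library; only the topology it induces,
   which is the Euclidean one, is used. Lengths are measured with [dot]. *)
Definition dot (R : realType) (m : nat) (u v : 'rV[R]_m) : R :=
  \sum_(i < m) u 0 i * v 0 i.

Definition basis_vec (R : realType) (n : nat) (i : 'I_n) : 'rV[R]_n :=
  delta_mx 0 i.

Definition partial (R : realType) (n : nat) (i : 'I_n) (f : 'rV[R]_n -> R)
  : 'rV[R]_n -> R := fun u => 'D_(basis_vec R i) f u.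

Fixpoint Ck_on (R : realType) (n m k : nat) (U : set 'rV[R]_n)
    (f : 'rV[R]_n -> 'rV[R]_m) : Prop :=
  match k with
  | 0%N => forall u, U u -> {for u, continuous f}
  | k'.+1 => (forall u, U u -> differentiable f u) /\
             (forall v : 'rV[R]_n, Ck_on k' U (fun u => 'D_v f u))
  end.

(* Meant for open [U]. *)
Definition smooth_on (R : realType) (n m : nat) (U : set 'rV[R]_n)
    (f : 'rV[R]_n -> 'rV[R]_m) : Prop := forall k, Ck_on k U f.

(* [cmap] and [cinv] are total functions; only their restrictions to [cdom] and
   to [cmap @` cdom], where they are mutually inverse homeomorphisms, matter. *)
Record chart (R : realType) (n : nat) (M : topologicalType) := Chart {
  cdom : set M;
  cmap : M -> 'rV[R]_n;
  cinv : 'rV[R]_n -> M;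
  cdom_open : open cdom;
  cimg_open : open (cmap @` cdom);
  cmap_continuous : {within cdom, continuous cmap};
  cinv_continuous : {within cmap @` cdom, continuous cinv};
  cmapK : forall p, cdom p -> cinv (cmap p) = p }.

Definition smooth_transition (R : realType) (n : nat) (M : topologicalType)
    (phi psi : chart R n M) : Prop :=
  smooth_on (cmap phi @` (cdom phi `&` cdom psi)) (cmap psi \o cinv phi).

Record smooth_manifold (R : realType) (n : nat) := SmoothManifold {
  carrier :> topologicalType;
  carrier_hausdorff : hausdorff_space carrier;
  carrier_second_countable : @second_countable carrier;
  atlas : set (chart R n carrier);
  chart_at : carrier -> chart R n carrier;
  chart_at_atlas : forall p, atlas (chart_at p);
  chart_at_dom : forall p, cdom (chart_at p) p;
  atlas_smooth : forall phi psi, atlas phi -> atlas psi ->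
    smooth_transition phi psi }.

Section Geometry.
Variables (R : realType) (n m : nat) (M : smooth_manifold R n).

Definition smooth_map (f : M -> 'rV[R]_m) : Prop :=
  forall phi, atlas phi -> smooth_on (cmap phi @` cdom phi) (f \o cinv phi).

(* A tangent vector at [p] is represented by its components [v] in a chart
   [phi] around [p]; this is the value of the differential of [f] on it. *)
Definition mdiff (f : M -> 'rV[R]_m) (phi : chart R n M) (p : M)
    (v : 'rV[R]_n) : 'rV[R]_m := 'd (f \o cinv phi) (cmap phi p) v.

Definition immersion (x : M -> 'rV[R]_m) : Prop :=
  smooth_map x /\
  forall phi p, atlas phi -> cdom phi p -> injective (mdiff x phi p).

Definition induced_metric (x : M -> 'rV[R]_m) (phi : chart R n M) (p : M)
    (v w : 'rV[R]_n) : R := dot (mdiff x phi p v) (mdiff x phi p w).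

(* g_ij as a function of the coordinate vector [u] of [phi] *)
Definition metric_mx (x : M -> 'rV[R]_m) (phi : chart R n M) (u : 'rV[R]_n)
    : 'M[R]_n :=
  \matrix_(i, j) induced_metric x phi (cinv phi u) (basis_vec R i)
                                                   (basis_vec R j).

(* Gamma^k_ij of the Levi-Civita connection of the induced metric *)
Definition christoffel (x : M -> 'rV[R]_m) (phi : chart R n M)
    (k i j : 'I_n) (u : 'rV[R]_n) : R :=
  let g a b := fun u' => metric_mx x phi u' a b in
  2^-1 * \sum_(l < n) invmx (metric_mx x phi u) k l *
    (partial i (g j l) u + partial j (g i l) u - partial l (g i j) u).

(* (nabla^2 f)(d_i, d_j) = d_i d_j f - sum_k Gamma^k_ij d_k f *)
Definition hessian_mx (x : M -> 'rV[R]_m) (phi : chart R n M) (f : M -> R)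
    (u : 'rV[R]_n) : 'M[R]_n :=
  \matrix_(i, j) (partial i (partial j (f \o cinv phi)) u -
    \sum_(k < n) christoffel x phi k i j u * partial k (f \o cinv phi) u).

(* Evaluated in the preferred chart at [p]; on smooth functions the value does
   not depend on the chart. *)
Definition laplacian (x : M -> 'rV[R]_m) (f : M -> R) (p : M) : R :=
  let phi := chart_at p in
  - \tr (invmx (metric_mx x phi (cmap phi p)) *m
         hessian_mx x phi f (cmap phi p)).

Definition laplace_map (x : M -> 'rV[R]_m) (p : M) : 'rV[R]_m :=
  \row_(a < m) laplacian x (fun q => x q 0 a) p.

Definition homothetic (x f : M -> 'rV[R]_m) : Prop :=
  exists2 c : R, 0 < c &
    forall phi p (v w : 'rV[R]_n), atlas phi -> cdom phi p ->
      dot (mdiff f phi p v) (mdiff f phi p w) =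
      c ^+ 2 * induced_metric x phi p v w.

End Geometry.

Definition hypersphere (R : realType) (m : nat) (a : 'rV[R]_m) (r : R)
    : set 'rV[R]_m := [set y | dot (y - a) (y - a) = r ^+ 2].

Definition open_portion_of_hypersphere (R : realType) (m : nat)
    (S : set 'rV[R]_m) : Prop :=
  exists (a : 'rV[R]_m) (r : R), 0 < r /\
    exists2 O : set 'rV[R]_m, open O & S = O `&` hypersphere a r.

(* Main.v *)
(* Let L = Delta x be homothetic with factor c, and put y = L / c. Then y is
   normal to x and <dy, dy> = <dx, dx>, so x and y are isometric immersions;
   write y = phi N with N a unit normal, dN = A and f = grad phi. The isometry
   reads phi^2 A^2 + f f^T = 1, and Delta x = c y gives tr A = c phi. Taking the
   tangential part of the second derivatives of y and using the Codazzi equation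
   of x, the second fundamental form tau of y satisfies tau = A + m f f^T wherever
   f does not vanish, and comparing the Gauss equations of x and y gives m = 0.
   Then the derivative of the trace equation yields S f = - c phi^2 f for
   S = phi A, while tr S = c phi^2 and S^2 = 1 - f f^T; by Cayley-Hamilton these
   are incompatible. Hence phi is constant, tau = -1 / phi, and the Gauss
   equation leaves only S = 1, i.e. dy = dx: M being connected, x - a = y for some
   a, and |x - a|^2 = 3 / c. The image is open in this sphere because x is an
   immersion. Conversely, on a sphere Beltrami's formula gives
   L = 3 / r^2 (x - a). *)
From HB Require Import structures.
Require Import Defs.
From mathcomp Require Import all_boot all_order all_algebra.
From mathcomp Require Import all_classical all_reals all_analysis.
From mathcomp Require Import ring lra.
Set Implicit Arguments.
Unset Strict Implicit.
Unset Printing Implicit Defensive.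
Import Order.TTheory GRing.Theory Num.Theory.
Import numFieldNormedType.Exports.
Local Open Scope classical_set_scope.
Local Open Scope ring_scope.

(** * Smooth functions *)

(** The second immersion replaces curvature tensors. As x and y induce the same metric, the products
    <d_a d_b x, d_d x> and <d_a d_b y, d_d y> coincide, so the intrinsic parts of the two Gauss
    equations cancel and no curvature has to be written down. What remains is a list of identities
    between inner products at one point, in a basis of constant vectors that is orthonormal at that
    point only; the price is that the trace equation is differentiated together with its inverse
    metric. phi vanishes nowhere: at a zero of y its three orthonormal derivatives would all lie on
    the normal line of x. Where f is not zero, a unit normal of y comes without a choice of root: S
    commutes with S^2 = 1 - f f^T, so S f = sigma f with sigma^2 + |f|^2 = 1, and sigma N - f is
    normal to y. That f = 0 must be known on an open set before its derivative yields tau. The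
    contracted Gauss equation then reads (tr S) S = 3, and tr S = c phi^2 > 0 selects S = 1 against
    S = -1; its trace 3 = c phi^2 is the origin of the radius. *)

Lemma near_eq_continuous (T S : topologicalType) (f g : T -> S) (a : T) :
  (\near a, f a = g a) -> {for a, continuous f} -> {for a, continuous g}.
Proof.
move=> fg cf; rewrite /prop_for /continuous_at -(nbhs_singleton fg).
exact: cvg_trans (near_eq_cvg fg) cf.
Qed.

Lemma near_eq_differentiable (R : numFieldType) (V W : normedModType R)
    (f g : V -> W) (a : V) :
  (\near a, f a = g a) -> differentiable f a -> differentiable g a.
Proof.
move=> fg df; have fga : f a = g a := nbhs_singleton fg.
have E : g \o shift a = cst (g a) + 'd f a +o_ (0 : V) id.
  apply/eqaddoP => e e0; have /diff_locally/eqaddoP/(_ e e0) := df.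
  have := fg; rewrite [X in X -> _](near_shift 0) subr0 => fg0.
  by apply: filter_app; near=> h; rewrite !fctE -fga -(near fg0 h).
have dE : 'd g a = 'd f a :> (V -> W) by exact: (diff_unique (diff_continuous df) E).
apply/diff_locallyP; rewrite dE; split; last exact: E.
exact: (diff_continuous df).
Unshelve. all: by end_near. Qed.

Lemma near_open (V : topologicalType) (T : Type) (U : set V) (f g : V -> T) u :
  open U -> U u -> (forall u, U u -> f u = g u) -> \near u, f u = g u.
Proof.
by move=> oU Uu fg; apply: filterS (open_nbhs_nbhs (conj oU Uu)) => z /fg.
Qed.

Section scalar_smooth.
Variables (R : realType) (n : nat).
Implicit Types (U : set 'rV[R]_n) (f g : 'rV[R]_n -> R).

(** Scalar twin of [Ck_on]: products, quotients and determinants are formed entrywise, so closure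
    properties are proved here and carried back to rows coordinate by coordinate. *)
Fixpoint Ck k U f : Prop :=
  match k with
  | 0%N => forall u, U u -> {for u, continuous f}
  | k'.+1 => (forall u, U u -> differentiable f u) /\
             (forall v : 'rV[R]_n, Ck k' U (fun u => 'D_v f u))
  end.

Lemma Ck_ext k U f g : open U -> (forall u, U u -> f u = g u) ->
  Ck k U f -> Ck k U g.
Proof.
move=> oU; elim: k f g => [|k IH] f g fg /=.
  move=> cf u Uu; exact: near_eq_continuous (near_open oU Uu fg) (cf _ Uu).
move=> [df Df]; split=> [u Uu|v].
  exact: near_eq_differentiable (near_open oU Uu fg) (df _ Uu).
apply: IH (Df v) => u Uu; apply: near_eq_derive; exact: near_open fg.
Qed.

Lemma Ck_pred k U f : Ck k.+1 U f -> Ck k U f.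
Proof.
elim: k f => [|k IH] f [df Df] //=.
  by move=> u /df; exact: differentiable_continuous.
by split=> // v; apply: IH; exact: Df.
Qed.

Lemma Ck_cst k U (c : R) : Ck k U (fun=> c).
Proof.
elim: k c => [|k IH] c /=; first by move=> u _; exact: cst_continuous.
split=> [u _|v]; first exact: differentiable_cst.
by under eq_fun do rewrite (derive_cst c); exact: IH.
Qed.

Lemma CkD k U f g : open U -> Ck k U f -> Ck k U g ->
  Ck k U (fun u => f u + g u).
Proof.
move=> oU; elim: k f g => [|k IH] f g /=.
  by move=> cf cg u Uu; apply: continuousD; [exact: cf|exact: cg].
move=> [df Df] [dg Dg]; split=> [u Uu|v].
  by apply: differentiableD; [exact: df|exact: dg].
apply: Ck_ext oU _ (IH _ _ (Df v) (Dg v)) => u Uu.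
by rewrite deriveD//; apply: diff_derivable; [exact: df|exact: dg].
Qed.

Lemma CkM k U f g : open U -> Ck k U f -> Ck k U g ->
  Ck k U (fun u => f u * g u).
Proof.
move=> oU; elim: k f g => [|k IH] f g Cf Cg.
  by move=> u Uu; apply: continuousM; [exact: Cf|exact: Cg].
have [[df Df] [dg Dg]] := (Cf, Cg); split=> [u Uu|v].
  by apply: differentiableM; [exact: df|exact: dg].
have := CkD oU (IH _ _ (Ck_pred Cf) (Dg v)) (IH _ _ (Ck_pred Cg) (Df v)).
apply: Ck_ext oU _ => u Uu.
by rewrite deriveM//; apply: diff_derivable; [exact: df|exact: dg].
Qed.

Lemma CkN k U f : open U -> Ck k U f -> Ck k U (fun u => - f u).
Proof.
move=> oU Cf; apply: Ck_ext oU _ (CkM oU (Ck_cst k U (-1)) Cf) => u _.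
by rewrite mulN1r.
Qed.

Lemma CkV k U f : open U -> (forall u, U u -> f u != 0) -> Ck k U f ->
  Ck k U (fun u => (f u)^-1).
Proof.
move=> oU f0; elim: k => [|k IH] Cf.
  by move=> u Uu; apply: (@cvgV _ _ (nbhs u) _ f); [exact: f0|exact: Cf].
have [df Df] := Cf; split=> [u Uu|v].
  by apply: differentiableV; [exact: df|exact: f0].
have CV := IH (Ck_pred Cf).
apply: Ck_ext oU _ (CkN oU (CkM oU (CkM oU CV CV) (Df v))) => u Uu.
rewrite deriveV ?f0//; last by apply: diff_derivable; exact: df.
by rewrite expr2 invfM scaleNr.
Qed.

Lemma Ck_sum k U (I : Type) (r : seq I) (P : pred I) (F : I -> 'rV[R]_n -> R) :
  open U -> (forall i, Ck k U (F i)) ->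
  Ck k U (fun u => \sum_(i <- r | P i) F i u).
Proof.
move=> oU CF; elim: r => [|i r IH].
  by under eq_fun do rewrite big_nil; exact: Ck_cst.
under eq_fun do rewrite big_cons; case: (P i) => //; exact: CkD.
Qed.

Lemma Ck_prod k U (I : Type) (r : seq I) (P : pred I) (F : I -> 'rV[R]_n -> R) :
  open U -> (forall i, Ck k U (F i)) ->
  Ck k U (fun u => \prod_(i <- r | P i) F i u).
Proof.
move=> oU CF; elim: r => [|i r IH].
  by under eq_fun do rewrite big_nil; exact: Ck_cst.
under eq_fun do rewrite big_cons; case: (P i) => //; exact: CkM.
Qed.

Lemma Ck_det k U m (A : 'rV[R]_n -> 'M[R]_m) : open U ->
  (forall i j, Ck k U (fun u => A u i j)) -> Ck k U (fun u => \det (A u)).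
Proof.
move=> oU CA; rewrite /determinant; apply: Ck_sum => // s.
by apply: CkM => //; [exact: Ck_cst|exact: Ck_prod].
Qed.

(** By the cofactor formula an entry of the inverse is a polynomial in the entries divided by the
    determinant. *)
Lemma Ck_invmx k U m (A : 'rV[R]_n -> 'M[R]_m) : open U ->
  (forall u, U u -> A u \in unitmx) ->
  (forall i j, Ck k U (fun u => A u i j)) ->
  forall i j, Ck k U (fun u => invmx (A u) i j).
Proof.
move=> oU uA CA i j.
apply: (@Ck_ext _ _ (fun u => (\det (A u))^-1 * cofactor (A u) j i)) => //.
  by move=> u Uu; rewrite /invmx uA// !mxE.
apply: CkM => //.
  apply: CkV => //; last exact: Ck_det.
  by move=> u /uA; rewrite unitmxE unitfE.
rewrite /cofactor; apply: CkM => //; first exact: Ck_cst.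
by apply: Ck_det => // i' j'; under eq_fun do rewrite !mxE; exact: CA.
Qed.

End scalar_smooth.

Section vector_smooth.
Variables (R : realType) (n m : nat).
Implicit Types (U : set 'rV[R]_n) (F G : 'rV[R]_n -> 'rV[R]_m).

Lemma derivable_coord F u v i : derivable F u v ->
  derivable (fun u => F u 0 i) u v.
Proof. by move/derivable_mxP; exact. Qed.

Lemma derive_coord F u v i : derivable F u v ->
  'D_v F u 0 i = 'D_v (fun u => F u 0 i) u.
Proof. by move=> dF; rewrite derive_mx// mxE. Qed.

Lemma differentiable_row F u :
  differentiable F u <-> forall i, differentiable (fun u => F u 0 i) u.
Proof.
split=> dF.
  move=> i; apply: (@differentiable_comp _ _ _ _ F (fun M => M 0 i)) => //.
  exact: differentiable_coord.
have -> : F = \sum_(i < m) (fun u => F u 0 i *: delta_mx 0 i).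
  apply/funext => z; rewrite fct_sumE; exact: row_sum_delta.
by apply: differentiable_sum => i; exact: differentiableZl.
Qed.

Lemma coord_Ck_on k U F i : open U -> Ck_on k U F -> Ck k U (fun u => F u 0 i).
Proof.
move=> oU; elim: k F => [|k IH] F /=.
  move=> cF u Uu; apply: (@continuous_comp _ _ _ F (fun M => M 0 i)).
    exact: cF.
  exact: coord_continuous.
move=> [dF DF]; split=> [u Uu|v]; first by have /differentiable_row := dF _ Uu; exact.
have := IH _ (DF v); apply: Ck_ext oU _ => u Uu.
by apply: derive_coord; apply: diff_derivable; exact: dF.
Qed.

(* One derivative is lost for convenience: differentiability of the coordinates
   is what gives continuity of the row at level 0. *)
Lemma Ck_on_coord k U F : open U ->
  (forall i, Ck k.+1 U (fun u => F u 0 i)) -> Ck_on k U F.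
Proof.
move=> oU; elim: k F => [|k IH] F CF.
  move=> u Uu; apply: differentiable_continuous; apply/differentiable_row => i.
  by have [dFi _] := CF i; exact: dFi.
have dF u : U u -> differentiable F u.
  by move=> Uu; apply/differentiable_row => i; have [dFi _] := CF i; exact: dFi.
split=> // v; apply: IH => i; have [_ /(_ v) Di] := CF i.
apply: (Ck_ext oU _ (Di : Ck k.+1 U _)) => u Uu.
by apply/esym/derive_coord; apply: diff_derivable; exact: dF.
Qed.

Lemma smooth_on_coord U F : open U ->
  smooth_on U F <-> forall i k, Ck k U (fun u => F u 0 i).
Proof.
move=> oU; split=> [sF i k|sF k]; first exact: coord_Ck_on (sF k).
exact: Ck_on_coord.
Qed.

Lemma smooth_on_sub U W F : W `<=` U -> smooth_on U F -> smooth_on W F.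
Proof.
move=> WU sF k; move: (sF k) => {sF}; elim: k F => [|k IH] F /=.
  by move=> cF u /WU; exact: cF.
by move=> [dF DF]; split=> [u /WU|v]; [exact: dF|exact: IH].
Qed.

Lemma smooth_on_differentiable U F u : smooth_on U F -> U u -> differentiable F u.
Proof. by move=> /(_ 1%N)[dF _] /dF. Qed.

Lemma smooth_on_derivable U F u v : smooth_on U F -> U u -> derivable F u v.
Proof. by move=> sF Uu; apply/diff_derivable/(smooth_on_differentiable sF). Qed.

Lemma smooth_on_derive U F v : smooth_on U F -> smooth_on U ('D_v F).
Proof. by move=> sF k; have [_] := sF k.+1; exact. Qed.

Lemma derivable_dot F G u v : derivable F u v -> derivable G u v ->
  derivable (fun u => dot (F u) (G u)) u v.
Proof.
move=> dF dG; rewrite /dot.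
rewrite (_ : (fun u => _) = \sum_(i < m) (fun u => F u 0 i * G u 0 i)).
  apply: derivable_sum => i.
  by apply: derivableM; exact: derivable_coord.
by apply/funext => z; rewrite fct_sumE.
Qed.

Lemma derive_dot F G u v : derivable F u v -> derivable G u v ->
  'D_v (fun u => dot (F u) (G u)) u = dot ('D_v F u) (G u) + dot (F u) ('D_v G u).
Proof.
move=> dF dG; rewrite /dot.
rewrite (_ : (fun u => _) = \sum_(i < m) (fun u => F u 0 i * G u 0 i)); last first.
  by apply/funext => z; rewrite fct_sumE.
rewrite derive_sum => [|i]; last by apply: derivableM; exact: derivable_coord.
rewrite -big_split; apply: eq_bigr => i _ /=.
rewrite deriveM; try exact: derivable_coord.
by rewrite !derive_coord// addrC; congr (_ + _); exact: mulrC.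
Qed.

End vector_smooth.

(** * Symmetry of second derivatives *)

Section lines.
Variables (R : realType) (n : nat) (W : normedModType R).
Implicit Types (f : 'rV[R]_n -> W) (u v w : 'rV[R]_n).

Lemma is_derive_line f u v (s : R) : derivable f (s *: v + u) v ->
  is_derive s 1 (fun t : R => f (t *: v + u)) ('D_v f (s *: v + u)).
Proof.
have E : (fun h : R => h^-1 *: (f ((h *: 1 + s) *: v + u) - f (s *: v + u))) =
         (fun h : R => h^-1 *: (f (h *: v + (s *: v + u)) - f (s *: v + u))).
  apply/funext => h; congr (_ *: (f _ - _)).
  by rewrite addrA -scalerDl; congr ((_ + _) *: _ + _); exact: mulr1.
by move=> df; split; rewrite /derivable /derive /= E.
Qed.

Lemma is_derive_translate f a u v : derivable f (a + u) v ->
  is_derive u v (fun z => f (a + z)) ('D_v f (a + u)).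
Proof.
have E : (fun h : R => h^-1 *: (f (a + (h *: v + u)) - f (a + u))) =
         (fun h : R => h^-1 *: (f (h *: v + (a + u)) - f (a + u))).
  by apply/funext => h; rewrite addrCA.
by move=> df; split; rewrite /derivable /derive /= E.
Qed.

End lines.

Section schwarz.
Variables (R : realType) (n : nat).
Implicit Types (U : set 'rV[R]_n) (f : 'rV[R]_n -> R) (u v w : 'rV[R]_n).

Lemma MVT_line f u v (t : R) : 0 < t ->
  (forall s : R, 0 <= s <= t -> derivable f (s *: v + u) v) ->
  exists2 s, 0 <= s <= t & f (t *: v + u) - f u = 'D_v f (s *: v + u) * t.
Proof.
move=> t0 df; pose g (s : R) := f (s *: v + u).
have dg (s : R) : 0 <= s <= t -> is_derive s 1 g ('D_v f (s *: v + u)).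
  by move=> st; apply: is_derive_line; exact: df.
have [|/=|c] := @MVT _ g (fun s => 'D_v f (s *: v + u)) 0 t t0.
- by move=> x; rewrite in_itv /= => /andP[x0 xt]; apply: dg; rewrite !ltW.
- apply: derivable_within_continuous => x; rewrite in_itv /= => x0t.
  by have [] := dg _ x0t.
rewrite in_itv /= => /andP[c0 ct]; rewrite subr0 /g scale0r add0r => E.
by exists c; rewrite // !ltW.
Qed.

Lemma near_parallelogram U u v w : open U -> U u ->
  \forall t \near (0 : R)^'+, forall r s : R, 0 <= r <= t -> 0 <= s <= t ->
     U (r *: v + (s *: w + u)).
Proof.
move=> oU Uu; have /nbhs_ballP[e /= e0 eU] : nbhs u U by exact: open_nbhs_nbhs.
have k0 : 0 < `|v| + `|w| + 1 by rewrite ltr_wpDl// addr_ge0.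
near=> t => r s /andP[r0 rt] /andP[s0 st]; apply: eU.
rewrite -ball_normE /ball_ /= addrA opprD addrCA subrr addr0.
rewrite normrN (le_lt_trans (ler_normD _ _))// !normrZ !ger0_norm//.
rewrite (@le_lt_trans _ _ (t * (`|v| + `|w| + 1)))//.
  rewrite !mulrDr mulr1 -[leLHS]addr0; apply: lerD; last exact: le_trans r0 rt.
  by apply: lerD; apply: ler_wpM2r.
by rewrite -ltr_pdivlMr//; near: t; apply: nbhs_right_lt; rewrite divr_gt0.
Unshelve. all: by end_near. Qed.

(** The mean value theorem is used twice: along [v] for the increment [g z = f (t *: w + z) - f z],
    then along [w] for ['D_v f]. *)
Lemma second_difference U f u v w (t : R) : 0 < t -> Ck 2 U f ->
  (forall r s : R, 0 <= r <= t -> 0 <= s <= t -> U (r *: v + (s *: w + u))) ->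
  exists r s : R, [/\ 0 <= r <= t, 0 <= s <= t &
    f (t *: v + (t *: w + u)) - f (t *: v + u) - f (t *: w + u) + f u =
    'D_w ('D_v f) (r *: v + (s *: w + u)) * t ^+ 2].
Proof.
move=> t0 [df Df] tU.
have tt : 0 <= t <= t by rewrite lexx ltW.
have z0 : 0 <= (0 : R) <= t by rewrite lexx ltW.
pose g z := f (t *: w + z) - f z.
have dfv (r s : R) : 0 <= r <= t -> 0 <= s <= t ->
    derivable f (r *: v + (s *: w + u)) v.
  by move=> rt st; apply/diff_derivable/df/tU.
have tU0 (r : R) : 0 <= r <= t -> U (r *: v + u).
  by move=> rt; have := tU _ _ rt z0; rewrite scale0r add0r.
have gv (r : R) : 0 <= r <= t -> is_derive (r *: v + u) v g
   ('D_v f (t *: w + (r *: v + u)) - 'D_v f (r *: v + u)).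
  move=> rt; apply: is_deriveB.
    by apply: is_derive_translate; rewrite addrCA; exact: dfv.
  by apply/derivableP/diff_derivable/df/tU0.
have [r rt Er] : exists2 r, 0 <= r <= t &
    g (t *: v + u) - g u = 'D_v g (r *: v + u) * t.
  by apply: (MVT_line (f := g) (u := u)) => // s st; have [] := gv _ st.
have [s st Es] : exists2 s, 0 <= s <= t & 'D_v f (t *: w + (r *: v + u)) -
    'D_v f (r *: v + u) = 'D_w ('D_v f) (s *: w + (r *: v + u)) * t.
  apply: (MVT_line (f := 'D_v f) (u := r *: v + u)) => // s st; have [dDf _] := Df v.
  by apply/diff_derivable/dDf; rewrite addrCA; exact: tU.
exists r, s; split => //.
have -> : f (t *: v + (t *: w + u)) - f (t *: v + u) - f (t *: w + u) + f u =
  g (t *: v + u) - g u by rewrite /g [t *: w + (_ + _)]addrCA; ring.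
have [_ gD] := gv _ rt.
by rewrite Er gD Es -mulrA -expr2 [s *: w + _]addrCA.
Qed.

(** Two different points [p] and [q] are allowed because the mean value theorem yields different
    intermediate points for the two orders of differentiation. *)
Lemma eq_of_near_values (a b : 'rV[R]_n -> R) u :
  {for u, continuous a} -> {for u, continuous b} ->
  (forall V, open V -> V u -> exists p q, [/\ V p, V q & a p = b q]) ->
  a u = b u.
Proof.
move=> ca cb H; apply/eqP; rewrite -subr_eq0 -normr_le0.
apply/ler_addgt0Pr => e e0; rewrite add0r.
have e2 : 0 < e / 2 by rewrite divr_gt0.
have close (g : 'rV[R]_n -> R) : {for u, continuous g} ->
    exists2 V : set 'rV[R]_n, open V /\ V u &
    forall z, V z -> `|g u - g z| < e / 2.
  move=> /cvgrPdist_lt/(_ _ e2).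
  by rewrite nearE nbhsE => -[V [oV Vu] VP]; exists V.
have [V1 [oV1 V1u] V1P] := close _ ca.
have [V2 [oV2 V2u] V2P] := close _ cb.
have [p [q [[Vp _] [_ Vq] E]]] := H _ (openI oV1 oV2) (conj V1u V2u).
have -> : a u - b u = (a u - a p) + (b q - b u) by rewrite E; ring.
rewrite (le_trans (ler_normD _ _))// (splitr e) lerD// ltW//; first exact: V1P.
by rewrite distrC; exact: V2P.
Qed.

(** The second difference is symmetric in [v] and [w], so for every small [t] both mixed
    derivatives, taken at suitable points of a small parallelogram, equal it divided by [t ^+ 2];
    continuity concludes. *)
Lemma deriveC U f u v w : open U -> U u -> Ck 2 U f ->
  'D_v ('D_w f) u = 'D_w ('D_v f) u.
Proof.
move=> oU Uu Cf.
have cont a b : {for u, continuous ('D_a ('D_b f))}.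
  by have [_ /(_ b)[_ /(_ a)]] := Cf; apply.
apply: (@eq_of_near_values ('D_v ('D_w f)) ('D_w ('D_v f)) u (cont _ _) (cont _ _)) => V oV Vu.
have oUV := openI oU oV; have UVu : (U `&` V) u by [].
near (0 : R)^'+ => t.
have t0 : 0 < t by [].
have tV : forall r s : R, 0 <= r <= t -> 0 <= s <= t ->
    (U `&` V) (r *: v + (s *: w + u)) by near: t; exact: near_parallelogram.
have tV' : forall r s : R, 0 <= r <= t -> 0 <= s <= t ->
    (U `&` V) (r *: w + (s *: v + u)) by near: t; exact: near_parallelogram.
have [r [s [rt st E]]] := second_difference t0 Cf (fun r s hr hs => (tV r s hr hs).1).
have [r' [s' [rt' st' E']]] :=
  second_difference t0 Cf (fun r s hr hs => (tV' r s hr hs).1).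
exists (r' *: w + (s' *: v + u)), (r *: v + (s *: w + u)).
split; [exact: (tV' _ _ rt' st').2|exact: (tV _ _ rt st).2|].
apply: (@mulIf _ (t ^+ 2)); first by rewrite expf_neq0// gt_eqF.
apply: etrans (esym E') _; apply: etrans _ E.
by rewrite [t *: w + (t *: v + u)]addrCA; ring.
Unshelve. all: by end_near. Qed.

End schwarz.

Section directional.
Variables (R : realType) (n : nat).
Implicit Types (u v : 'rV[R]_n).

Lemma derive_rV_sum (W : normedModType R) (f : 'rV[R]_n -> W) u v :
  differentiable f u -> 'D_v f u = \sum_(k < n) v 0 k *: 'D_(basis_vec R k) f u.
Proof.
move=> df; rewrite deriveE// {1}(row_sum_delta v) linear_sum.
by apply: eq_bigr => k _; rewrite linearZ deriveE.
Qed.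

Lemma derive_lin (W : normedModType R) (f : 'rV[R]_n -> W) u (I : finType)
    (c : I -> R) (v : I -> 'rV[R]_n) : differentiable f u ->
  'D_(\sum_i c i *: v i) f u = \sum_i c i *: 'D_(v i) f u.
Proof.
move=> df; rewrite deriveE// linear_sum.
by apply: eq_bigr => k _; rewrite linearZ deriveE.
Qed.

End directional.

(** * Chain rules of first and second order *)

Section composition.
Variables (R : realType) (n : nat).
Implicit Types (u v : 'rV[R]_n).

Lemma derive_comp (m : nat) (W : normedModType R) (f : 'rV[R]_m -> W)
    (t : 'rV[R]_n -> 'rV[R]_m) u v :
  differentiable t u -> differentiable f (t u) ->
  'D_v (f \o t) u = 'D_('D_v t u) f (t u).
Proof.
move=> dt df; rewrite deriveE; last exact: differentiable_comp.
by rewrite diff_comp//= !deriveE.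
Qed.

(** The inner direction ['D_b t z] moves with [z]; expanding it along the standard basis turns the
    first derivative into a sum of products, to which the Leibniz rule applies. *)
Lemma derive2_comp (m : nat) (f : 'rV[R]_m -> R) (t : 'rV[R]_n -> 'rV[R]_m)
    (U : set 'rV[R]_n) (V : set 'rV[R]_m) u a b :
  open U -> open V -> (forall z, U z -> V (t z)) -> U u ->
  smooth_on U t -> Ck 2 V f ->
  'D_a ('D_b (f \o t)) u =
  'D_('D_a t u) ('D_('D_b t u) f) (t u) + 'D_('D_a ('D_b t) u) f (t u).
Proof.
move=> oU oV UV Uu st [df Df].
have dt z : U z -> differentiable t z by exact: smooth_on_differentiable.
have dDt z : U z -> differentiable ('D_b t) z.
  by apply: smooth_on_differentiable; exact: smooth_on_derive.
have dDf (w : 'rV[R]_m) z : V z -> differentiable ('D_w f) z.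
  by have [Dw _] := Df w; exact: Dw.
pose g k z := 'D_b t z 0 k * 'D_(basis_vec R k) f (t z).
have dg k : derivable (g k) u a.
  apply: derivableM; first exact/derivable_coord/diff_derivable/dDt.
  apply: diff_derivable.
  apply: (@differentiable_comp _ _ _ _ t ('D_(basis_vec R k) f)).
    exact: dt.
  exact/dDf/UV.
have -> : 'D_a ('D_b (f \o t)) u = 'D_a (\sum_k g k) u.
  apply: near_eq_derive; apply: near_open oU Uu _ => z Uz.
  rewrite derive_comp//; [|exact: dt|exact/df/UV].
  rewrite (derive_rV_sum _ (df _ (UV _ Uz))).
  by rewrite fct_sumE; apply: eq_bigr.
rewrite derive_sum// (derive_rV_sum _ (df _ (UV _ Uu))).
have -> : 'D_('D_a t u) ('D_('D_b t u) f) (t u) =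
    'D_('D_a t u) (\sum_k 'D_b t u 0 k *: 'D_(basis_vec R k) f) (t u).
  apply: near_eq_derive; apply: near_open oV (UV _ Uu) _ => z Vz.
  rewrite (derive_rV_sum _ (df _ Vz)).
  by rewrite fct_sumE; apply: eq_bigr.
rewrite derive_sum => [|k]; last exact/derivableZ/diff_derivable/dDf/UV.
rewrite -big_split; apply: eq_bigr => k _ /=.
rewrite deriveZ; last exact/diff_derivable/dDf/UV.
rewrite deriveM; last 2 first.
- exact/derivable_coord/diff_derivable/dDt.
- apply: diff_derivable.
  apply: (@differentiable_comp _ _ _ _ t ('D_(basis_vec R k) f)).
    exact: dt.
  exact/dDf/UV.
rewrite (derive_comp (f := 'D_(basis_vec R k) f)); [|exact: dt|exact/dDf/UV].
have -> : 'D_a ('D_b t) u 0 k = 'D_a (fun z => 'D_b t z 0 k) u.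
  by apply: derive_coord; exact/diff_derivable/dDt.
congr (_ + _).
exact: mulrC.
Qed.

End composition.

Section vector_directional.
Variables (R : realType) (n m : nat).
Implicit Types (U : set 'rV[R]_n) (F : 'rV[R]_n -> 'rV[R]_m).

Lemma smooth_on_dot_cst U F (N : 'rV[R]_m) k : open U -> smooth_on U F ->
  Ck k U (fun z => dot (F z) N).
Proof.
move=> oU /(smooth_on_coord _ oU) sF; apply: Ck_sum => // i.
by apply: CkM => //; exact: Ck_cst.
Qed.

Lemma derive_dot_cst F (N : 'rV[R]_m) u v : derivable F u v ->
  'D_v (fun z => dot (F z) N) u = dot ('D_v F u) N.
Proof.
move=> dF; apply: etrans (derive_dot dF (derivable_cst N u v)) _.
rewrite derive_cst /dot [X in _ + X]big1 ?addr0// => i _.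
by rewrite mxE mulr0.
Qed.

Lemma derive2_dot_cst U F (N : 'rV[R]_m) u v w : open U -> U u -> smooth_on U F ->
  'D_v ('D_w (fun z => dot (F z) N)) u = dot ('D_v ('D_w F) u) N.
Proof.
move=> oU Uu sF; rewrite -derive_dot_cst; last first.
  by apply: smooth_on_derivable Uu; exact: smooth_on_derive.
apply: near_eq_derive; apply: near_open oU Uu _ => z Uz.
by rewrite derive_dot_cst//; exact: smooth_on_derivable Uz.
Qed.

Lemma dot_delta (y : 'rV[R]_m) i : dot y (delta_mx 0 i) = y 0 i.
Proof.
rewrite /dot (bigD1 i)//= big1 ?addr0 => [|j ji]; first by rewrite mxE !eqxx mulr1.
by rewrite mxE eqxx (negPf ji) mulr0.
Qed.

Lemma smooth_deriveC U F u v w : open U -> U u -> smooth_on U F ->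
  'D_v ('D_w F) u = 'D_w ('D_v F) u.
Proof.
move=> oU Uu sF; apply/rowP => i; rewrite -[LHS]dot_delta -[RHS]dot_delta.
apply: etrans (esym (derive2_dot_cst _ v w oU Uu sF)) _.
apply: etrans _ (derive2_dot_cst _ w v oU Uu sF).
by apply: (deriveC v w oU Uu); exact: smooth_on_dot_cst.
Qed.

(** The mean value theorem, one coordinate at a time, on the segment from [u] to [z], which stays in
    the ball by convexity. *)
Lemma locally_cst F u (e : R) :
  (forall z, ball u e z -> differentiable F z) ->
  (forall z v, ball u e z -> 'D_v F z = 0) ->
  forall z, ball u e z -> F z = F u.
Proof.
move=> dF DF z uz; apply/rowP => i.
have hz (s : R) : 0 <= s <= 1 -> ball u e (s *: (z - u) + u).
  move=> /andP[s0 s1]; move: uz; rewrite -!ball_normE /ball_ /=.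
  rewrite opprD addrCA subrr addr0 normrN normrZ ger0_norm// distrC.
  by apply: le_lt_trans; rewrite ler_piMl.
have dFi (s : R) v : 0 <= s <= 1 ->
    derivable (fun y => F y 0 i) (s *: (z - u) + u) v.
  by move=> s01; exact/derivable_coord/diff_derivable/dF/hz.
have [s s01] := @MVT_line R n (fun y => F y 0 i) u (z - u) 1 ltr01
  (fun s hs => dFi s (z - u) hs).
rewrite -derive_coord; last exact/diff_derivable/dF/hz.
rewrite DF; last exact: hz.
by rewrite mxE mul0r scale1r subrK => /eqP; rewrite subr_eq0 => /eqP.
Qed.

End vector_directional.

(* Sealed: unification would otherwise try to decide equations between iterated
   derivatives by unfolding the limits that define them. *)
HB.lock Definition pd (R : realType) (n m : nat) (v : 'rV[R]_n)
  (F : 'rV[R]_n -> 'rV[R]_m) (u : 'rV[R]_n) : 'rV[R]_m := 'D_v F u.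

Section sealed_derivative.
Variables (R : realType) (n m : nat).
Implicit Types (U : set 'rV[R]_n) (F G : 'rV[R]_n -> 'rV[R]_m).

Lemma pdE v F : pd v F = 'D_v F.
Proof. by apply/funext => u; rewrite pd.unlock. Qed.

Lemma smooth_pd U F v : smooth_on U F -> smooth_on U (pd v F).
Proof. by rewrite pdE; exact: smooth_on_derive. Qed.

Lemma pdC U F u v w : open U -> U u -> smooth_on U F ->
  pd v (pd w F) u = pd w (pd v F) u.
Proof. by rewrite !pdE; exact: smooth_deriveC. Qed.

Lemma eq_pd U F G u v : open U -> U u -> (forall z, U z -> F z = G z) ->
  pd v F u = pd v G u.
Proof.
by rewrite !pdE => oU Uu FG; apply: near_eq_derive; exact: near_open oU Uu FG.
Qed.

Lemma pd_cst (y : 'rV[R]_m) (u v : 'rV[R]_n) : pd v (fun=> y) u = 0.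
Proof. by rewrite pdE derive_cst. Qed.

Lemma smooth_on_cst U (y : 'rV[R]_m) : open U -> smooth_on U (fun=> y).
Proof. by move=> oU; apply/smooth_on_coord => // i k; exact: Ck_cst. Qed.

Lemma pd_lin F u (I : finType) (c : I -> R) (v : I -> 'rV[R]_n) :
  differentiable F u -> pd (\sum_i c i *: v i) F u = \sum_i c i *: pd (v i) F u.
Proof.
move=> dF; rewrite pdE derive_lin//.
by apply: eq_bigr => i _; rewrite pdE.
Qed.

Lemma derive_smooth_dot U F G u v : U u -> smooth_on U F -> smooth_on U G ->
  'D_v (fun z => dot (F z) (G z)) u = dot (pd v F u) (G u) + dot (F u) (pd v G u).
Proof.
by move=> Uu sF sG; rewrite !pdE; apply: derive_dot;
  [exact: smooth_on_derivable sF Uu|exact: smooth_on_derivable sG Uu].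
Qed.

(** The form in which identities between inner products are differentiated; a vanishing or constant
    right-hand side is supplied as the product of constant fields. *)
Lemma derive_dot_eq U F G F' G' u v : open U -> U u ->
  smooth_on U F -> smooth_on U G -> smooth_on U F' -> smooth_on U G' ->
  (forall z, U z -> dot (F z) (G z) = dot (F' z) (G' z)) ->
  dot (pd v F u) (G u) + dot (F u) (pd v G u) =
  dot (pd v F' u) (G' u) + dot (F' u) (pd v G' u).
Proof.
move=> oU Uu sF sG sF' sG' FG.
apply: etrans (esym (derive_smooth_dot v Uu sF sG)) _.
apply: etrans _ (derive_smooth_dot v Uu sF' sG').
by apply: near_eq_derive; exact: near_open oU Uu FG.
Qed.

End sealed_derivative.

(** * Orthonormal frames *)

Section dot_algebra.
Variables (R : realType) (m : nat).
Implicit Types u v w : 'rV[R]_m.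

Lemma dotC u v : dot u v = dot v u.
Proof. by apply: eq_bigr => i _; rewrite mulrC. Qed.

Lemma dotDl u v w : dot (u + v) w = dot u w + dot v w.
Proof. by rewrite -big_split; apply: eq_bigr => i _; rewrite mxE mulrDl. Qed.

Lemma dotZl a u v : dot (a *: u) v = a * dot u v.
Proof. by rewrite mulr_sumr; apply: eq_bigr => i _; rewrite mxE mulrA. Qed.

Lemma dotNl u v : dot (- u) v = - dot u v.
Proof. by rewrite -scaleN1r dotZl mulN1r. Qed.

Lemma dotBl u v w : dot (u - v) w = dot u w - dot v w.
Proof. by rewrite dotDl dotNl. Qed.

Lemma dot0l u : dot 0 u = 0.
Proof. by rewrite -(scale0r 0) dotZl mul0r. Qed.

Lemma dot_suml (I : Type) (r : seq I) (P : pred I) (F : I -> 'rV[R]_m) v :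
  dot (\sum_(i <- r | P i) F i) v = \sum_(i <- r | P i) dot (F i) v.
Proof.
apply: (big_ind2 (fun x y => dot x v = y)) => //; first exact: dot0l.
by move=> ? ? ? ? <- <-; exact: dotDl.
Qed.

Lemma dotDr u v w : dot w (u + v) = dot w u + dot w v.
Proof. by rewrite dotC dotDl !(dotC w). Qed.

Lemma dotZr a u v : dot v (a *: u) = a * dot v u.
Proof. by rewrite dotC dotZl (dotC v). Qed.

Lemma dotNr u v : dot u (- v) = - dot u v.
Proof. by rewrite dotC dotNl dotC. Qed.

Lemma dotBr u v w : dot w (u - v) = dot w u - dot w v.
Proof. by rewrite dotDr dotNr. Qed.

Lemma dot0r u : dot u 0 = 0.
Proof. by rewrite dotC dot0l. Qed.

Lemma dot_sumr (I : Type) (r : seq I) (P : pred I) (F : I -> 'rV[R]_m) v :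
  dot v (\sum_(i <- r | P i) F i) = \sum_(i <- r | P i) dot v (F i).
Proof. by rewrite dotC dot_suml; apply: eq_bigr => i _; rewrite dotC. Qed.

Lemma dot_mulmx u v : dot u v = (u *m v^T) 0 0.
Proof. by rewrite mxE; apply: eq_bigr => i _; rewrite mxE. Qed.

Lemma dot_ge0 u : 0 <= dot u u.
Proof. by apply: sumr_ge0 => i _; rewrite -expr2 sqr_ge0. Qed.

Lemma dot_eq0 u : (dot u u == 0) = (u == 0).
Proof.
apply/idP/eqP => [|->]; last by rewrite dot0l.
rewrite psumr_eq0 => [/allP u0|i _]; last by rewrite -expr2 sqr_ge0.
apply/rowP => i; have := u0 i (mem_index_enum _).
by rewrite mxE -expr2 sqrf_eq0 => /eqP.
Qed.

Lemma dot_gt0 u : (0 < dot u u) = (u != 0).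
Proof. by rewrite lt0r dot_eq0 dot_ge0 andbT. Qed.

Lemma eq_dot u v : (forall w, dot u w = dot v w) -> u = v.
Proof.
move=> uv; apply/eqP; rewrite -subr_eq0 -dot_eq0 dotBl uv.
by rewrite subrr.
Qed.

End dot_algebra.

Section frames.
Variables (R : realType) (k : nat).

(** With rows [N] and [E a] the square matrix [Q] satisfies [Q *m Q^T = 1], hence also
    [Q^T *m Q = 1]: [k] orthonormal vectors and a unit normal exhaust dimension [k.+1]. *)
Lemma dot_frame (E : 'I_k -> 'rV[R]_k.+1) (N u v : 'rV[R]_k.+1) :
  (forall a b, dot (E a) (E b) = (a == b)%:R) -> (forall a, dot (E a) N = 0) ->
  dot N N = 1 ->
  dot u v = \sum_a dot u (E a) * dot v (E a) + dot u N * dot v N.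
Proof.
move=> hE hEN hN; pose Q : 'M[R]_k.+1 := (col_mx N (\matrix_(a < k) E a) : 'M[R]_(1 + k, k.+1)).
pose e (i : 'I_k.+1) : 'rV[R]_k.+1 := if unlift ord0 i is Some a then E a else N.
have rowQ i : row i Q = e i.
  apply/rowP => j; rewrite mxE /Q /e; case: unliftP => [a|] ->.
    have -> : lift ord0 a = rshift 1 a by apply: ord_inj.
    by apply: etrans (col_mxEd _ _ _ _) _; rewrite mxE.
  have -> : ord0 = lshift k 0 :> 'I_(1 + k) by apply: ord_inj.
  exact: col_mxEu.
have dotQ (x : 'rV[R]_k.+1) i : (x *m Q^T) 0 i = dot x (e i).
  by rewrite mxE /dot -rowQ; apply: eq_bigr => j _; rewrite !mxE.
have OO : Q *m Q^T = 1%:M.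
  apply/matrixP => i j; have := dotQ (row i Q) j.
  rewrite -row_mul [in X in X = _ -> _]mxE => ->; rewrite rowQ /e mxE.
  case: unliftP => [a|] ->; case: unliftP => [b|] -> //.
  by rewrite dotC hEN (negPf (neq_lift _ _)).
have -> : dot u v = dot (u *m Q^T) (v *m Q^T).
  rewrite !dot_mulmx trmx_mul trmxK -mulmxA [Q^T *m _]mulmxA.
  by rewrite (mulmx1C OO) mul1mx.
rewrite {1}/dot big_ord_recl addrC !dotQ /e unlift_none; congr (_ + _).
by apply: eq_bigr => a _; rewrite !dotQ /e liftK.
Qed.

End frames.

(** * Algebra of symmetric forms in dimension three *)

Section sum3.
Variable R : realType.

Definition i0 : 'I_3 := ord0.
Definition i1 : 'I_3 := lift ord0 ord0.
Definition i2 : 'I_3 := lift ord0 (lift ord0 ord0).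

Lemma sum3E (F : 'I_3 -> R) : \sum_a F a = F i0 + F i1 + F i2.
Proof. by rewrite !big_ord_recl big_ord0 addr0 addrA. Qed.

Lemma forall3 (P : 'I_3 -> Prop) : P i0 -> P i1 -> P i2 -> forall a, P a.
Proof.
move=> P0 P1 P2 a; case: (unliftP ord0 a) => [b|] -> //.
case: (unliftP ord0 b) => [c|] -> //.
by case: (unliftP ord0 c) => [d|] -> //; case: d.
Qed.

(* Cayley-Hamilton: [S^2 = 1 - f f^T] and [S f = - t f] give
   [S^3 + t S^2 - S - t = 0], to be compared with
   [S^3 - t S^2 - S - det S = 0]. *)
Lemma sym3_grad0 (a b c d e f x y z t : R) :
  0 < t -> a + d + f = t ->
  a * a + b * b + c * c = 1 - x * x -> a * b + b * d + c * e = - (x * y) ->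
  a * c + b * e + c * f = - (x * z) -> b * b + d * d + e * e = 1 - y * y ->
  b * c + d * e + e * f = - (y * z) -> c * c + e * e + f * f = 1 - z * z ->
  a * x + b * y + c * z = - (t * x) -> b * x + d * y + e * z = - (t * y) ->
  c * x + e * y + f * z = - (t * z) ->
  [/\ x = 0, y = 0 & z = 0].
Proof.
move=> t0 tr h11 h12 h13 h22 h23 h33 hx hy hz.
pose T := a + d + f - t; have T0 : T = 0 by rewrite /T tr subrr.
pose H11 := a * a + b * b + c * c + x * x - 1.
have H11_0 : H11 = 0 by rewrite /H11 h11; ring.
pose H12 := a * b + b * d + c * e + x * y.
have H12_0 : H12 = 0 by rewrite /H12 h12; ring.
pose H13 := a * c + b * e + c * f + x * z.
have H13_0 : H13 = 0 by rewrite /H13 h13; ring.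
pose H22 := b * b + d * d + e * e + y * y - 1.
have H22_0 : H22 = 0 by rewrite /H22 h22; ring.
pose H23 := b * c + d * e + e * f + y * z.
have H23_0 : H23 = 0 by rewrite /H23 h23; ring.
pose H33 := c * c + e * e + f * f + z * z - 1.
have H33_0 : H33 = 0 by rewrite /H33 h33; ring.
pose K1 := a * x + b * y + c * z + t * x.
have K1_0 : K1 = 0 by rewrite /K1 hx; ring.
pose K2 := b * x + d * y + e * z + t * y.
have K2_0 : K2 = 0 by rewrite /K2 hy; ring.
pose K3 := c * x + e * y + f * z + t * z.
have K3_0 : K3 = 0 by rewrite /K3 hz; ring.
pose H0 := (T0, H11_0, H12_0, H13_0, H22_0, H23_0, H33_0, K1_0, K2_0, K3_0).
(* Evaluating S^2 f as t^2 f and as (1 - |f|^2) f gives [P] f = 0, so only the case [P = 0] is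
   left. *)
pose P := 1 - (x * x + y * y + z * z) - t * t.
have xP : x * P = 0.
  rewrite (_ : x * P = a * K1 + b * K2 + c * K3 - t * K1 -
    (H11 * x + H12 * y + H13 * z)); first by rewrite !H0; ring.
  by rewrite /P /K1 /K2 /K3 /H11 /H12 /H13; ring.
have yP : y * P = 0.
  rewrite (_ : y * P = b * K1 + d * K2 + e * K3 - t * K2 -
    (H12 * x + H22 * y + H23 * z)); first by rewrite !H0; ring.
  by rewrite /P /K1 /K2 /K3 /H12 /H22 /H23; ring.
have zP : z * P = 0.
  rewrite (_ : z * P = c * K1 + e * K2 + f * K3 - t * K3 -
    (H13 * x + H23 * y + H33 * z)); first by rewrite !H0; ring.
  by rewrite /P /K1 /K2 /K3 /H13 /H23 /H33; ring.
have [P0|Pn0] := eqVneq P 0; last first.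
  by split; apply/eqP; [move: xP|move: yP|move: zP] => /eqP;
     rewrite mulf_eq0 (negPf Pn0) orbF.
(* [Z - 1] is the second elementary symmetric function of the eigenvalues, half of (tr S)^2 - tr
   S^2, which equals -1 once [P = 0]. *)
pose Z := a * d + a * f + d * f - b * b - c * c - e * e + 1.
have Z0 : Z = 0.
  suff : 2 * Z = 0 by move=> /eqP; rewrite mulf_eq0 pnatr_eq0 /= => /eqP.
  rewrite (_ : 2 * Z = T * T + 2 * T * t - (H11 + H22 + H33) - P).
    by rewrite !H0 P0; ring.
  by rewrite /Z /P /T /H11 /H22 /H33; ring.
pose D := a * (d * f - e * e) - b * (b * f - e * c) + c * (b * e - d * c).
(* The comparison amounts to 2 t f f^T = (t + D) 1, with [D] the determinant; this and the next five
   claims are its entries. A scalar matrix of the form f f^T in dimension three is zero. *)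
have xy : t * (x * y) = 0.
  suff : 2 * (t * (x * y)) = 0 by lra.
  rewrite (_ : 2 * (t * (x * y)) = - (a * H12 + b * H22 + c * H23) + y * K1 +
    (T + t) * H12 - T * (x * y) - Z * b); first by rewrite !H0 Z0; ring.
  by rewrite /Z /T /K1 /H12 /H22 /H23; ring.
have xz : t * (x * z) = 0.
  suff : 2 * (t * (x * z)) = 0 by lra.
  rewrite (_ : 2 * (t * (x * z)) = - (a * H13 + b * H23 + c * H33) + z * K1 +
    (T + t) * H13 - T * (x * z) - Z * c); first by rewrite !H0 Z0; ring.
  by rewrite /Z /T /K1 /H13 /H23 /H33; ring.
have yz : t * (y * z) = 0.
  suff : 2 * (t * (y * z)) = 0 by lra.
  rewrite (_ : 2 * (t * (y * z)) = - (b * H13 + d * H23 + e * H33) + z * K2 +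
    (T + t) * H23 - T * (y * z) - Z * e); first by rewrite !H0 Z0; ring.
  by rewrite /Z /T /K2 /H13 /H23 /H33; ring.
have Dx : 2 * (t * (x * x)) - t = D.
  rewrite (_ : D = a * H11 + b * H12 + c * H13 - x * K1 + 2 * (t * (x * x)) - t
     + T * (x * x) - T - (T + t) * H11 + Z * a); first by rewrite !H0 Z0; ring.
  by rewrite /D /Z /T /K1 /H11 /H12 /H13; ring.
have Dy : 2 * (t * (y * y)) - t = D.
  rewrite (_ : D = b * H12 + d * H22 + e * H23 - y * K2 + 2 * (t * (y * y)) - t
     + T * (y * y) - T - (T + t) * H22 + Z * d); first by rewrite !H0 Z0; ring.
  by rewrite /D /Z /T /K2 /H12 /H22 /H23; ring.
have Dz : 2 * (t * (z * z)) - t = D.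
  rewrite (_ : D = c * H13 + e * H23 + f * H33 - z * K3 + 2 * (t * (z * z)) - t
     + T * (z * z) - T - (T + t) * H33 + Z * f); first by rewrite !H0 Z0; ring.
  by rewrite /D /Z /T /K3 /H13 /H23 /H33; ring.
have t_inj u v : t * u = t * v -> u = v by apply: mulfI; rewrite gt_eqF.
have {}xy : x * y = 0 by apply: t_inj; rewrite xy mulr0.
have {}yz : y * z = 0 by apply: t_inj; rewrite yz mulr0.
have exy : x * x = y * y by apply: t_inj; lra.
have eyz : y * y = z * z by apply: t_inj; lra.
have sq0 (u : R) : u * u = 0 -> u = 0 by move/eqP; rewrite mulf_eq0 orbb => /eqP.
have x0 : x = 0.
  apply/sq0/sq0.
  have -> : x * x * (x * x) = (x * y) * (x * y) + x * x * (x * x - y * y) by ring.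
  by rewrite xy exy subrr; ring.
have y0 : y = 0 by apply: sq0; rewrite -exy x0 mul0r.
by split=> //; apply: sq0; rewrite -eyz y0 mul0r.
Qed.

End sum3.

Section shape_algebra.
Variable R : realType.

(* Codazzi forces [tau = A + m f f^T]; then Gauss leaves [m = 0] or
   [A] of rank one, the latter being excluded by [phi^2 A^2 + f f^T = 1]. *)
Lemma shape_grad0 (A tau : 'I_3 -> 'I_3 -> R) (f : 'I_3 -> R) (phi c sigma : R) :
  0 < phi -> 0 < c ->
  (forall a b, A a b = A b a) -> (forall a b, tau a b = tau b a) ->
  (forall a b, phi ^+ 2 * (\sum_d A a d * A b d) + f a * f b = (a == b)%:R) ->
  (forall a, phi * (\sum_b A a b * f b) = sigma * f a) ->
  (forall a b d, (tau b d - A b d) * f a = (tau a d - A a d) * f b) ->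
  (forall a b d e, A a b * A d e - A a e * A d b =
                   tau a b * tau d e - tau a e * tau d b) ->
  \sum_a A a a = c * phi ->
  (forall d, \sum_a f a * (tau a d + A a d) = - (2 * c * phi * f d)) ->
  forall a, f a = 0.
Proof.
move=> phi0 c0 symA symt hS hf hC hG tr gr.
pose Phi := \sum_a f a * f a.
have [Phi0|Phin0] := eqVneq Phi 0.
  have /psumr_eq0P : \sum_a f a ^+ 2 = 0.
    by rewrite -[RHS]Phi0; apply: eq_bigr => a _; rewrite expr2.
  by move=> H a; apply/eqP; rewrite -sqrf_eq0 H// => i _; exact: sqr_ge0.
pose alpha := sigma / phi.
have Af a : \sum_b A a b * f b = alpha * f a.
  apply: (mulfI (lt0r_neq0 phi0)); rewrite hf /alpha mulrA mulrCA mulfV ?mulr1//.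
  exact: lt0r_neq0.
(* Contracting [hC] with [f] makes [tau - A] the product of [f] and [w] up to the factor [Phi];
   symmetry of [tau - A] then makes [w] parallel to [f]. *)
pose w d := \sum_a (tau a d - A a d) * f a.
have Ww b d : (tau b d - A b d) * Phi = f b * w d.
  rewrite /Phi /w !mulr_sumr; apply: eq_bigr => a _.
  by rewrite mulrA hC; ring.
pose omega := \sum_b w b * f b.
have wo d : w d * Phi = f d * omega.
  rewrite /Phi /omega !mulr_sumr; apply: eq_bigr => b _.
  have : f b * w d = f d * w b by rewrite -!Ww symt symA.
  by move=> h; rewrite mulrA (mulrC (w d)) h; ring.
pose m := omega / Phi ^+ 2.
have tauE b d : tau b d = A b d + m * f b * f d.
  apply/eqP; rewrite addrC -subr_eq; apply/eqP.
  apply: (mulIf (x := Phi ^+ 2)); first by rewrite expf_neq0.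
  have -> : (tau b d - A b d) * Phi ^+ 2 = f b * (w d * Phi).
    by rewrite mulrA -Ww; ring.
  by rewrite wo /m; field.
have [m0|mn0] := eqVneq m 0; last first.
  exfalso; have [] := negP Phin0.
  (* The terms quadratic in [m] cancel because f f^T has rank one, so the Gauss identity is linear
     in [m] and [m] can be divided out. *)
  have X a b d e : A a b * f d * f e + f a * f b * A d e
      - A a e * f d * f b - f a * f e * A d b = 0.
    apply: (mulfI mn0); rewrite mulr0; have := hG a b d e.
    move/eqP; rewrite eq_sym -subr_eq0 => /eqP <-; rewrite !tauE; ring.
  have Y a b d : A a b * f d = f a * A d b.
    apply: (mulIf Phin0); apply/eqP; rewrite -subr_eq0; apply/eqP.
    have E : \sum_e f e * (A a b * f d * f e + f a * f b * A d e
      - A a e * f d * f b - f a * f e * A d b) = 0.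
      by apply: big1 => e _; rewrite X mulr0.
    have -> : A a b * f d * Phi - f a * A d b * Phi =
      \sum_e f e * (A a b * f d * f e + f a * f b * A d e
        - A a e * f d * f b - f a * f e * A d b)
      - f a * f b * (\sum_e A d e * f e - alpha * f d)
      + f d * f b * (\sum_e A a e * f e - alpha * f a).
      by rewrite /Phi !sum3E; ring.
    by rewrite E !Af !subrr; ring.
  have rk1 a b : A a b * Phi = alpha * (f a * f b).
    rewrite mulrCA -(Af b) /Phi !mulr_sumr; apply: eq_bigr => d _.
    by rewrite mulrA Y (symA d b); ring.
  pose s := phi ^+ 2 * alpha ^+ 2 * Phi + Phi ^+ 2.
  have sff a b : s * (f a * f b) = (a == b)%:R * Phi ^+ 2.
    have -> : (a == b)%:R * Phi ^+ 2 = phi ^+ 2 *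
      (\sum_d A a d * A b d * Phi ^+ 2) + f a * f b * Phi ^+ 2.
      by rewrite -hS -mulr_suml; ring.
    have -> : \sum_d A a d * A b d * Phi ^+ 2 = alpha ^+ 2 * (f a * f b) * Phi.
      rewrite mulr_sumr; apply: eq_bigr => d _.
      have -> : A a d * A b d * Phi ^+ 2 = (A a d * Phi) * (A b d * Phi) by ring.
      by rewrite !rk1; ring.
    by rewrite /s; ring.
  suff : Phi ^+ 2 * Phi ^+ 2 == 0 by rewrite mulf_eq0 !expf_eq0 /= orbb.
  (* A rank one form satisfies h00 h11 = h01^2, and a nonzero multiple of the identity does not. *)
  have := sff i0 i0; have := sff i1 i1; have := sff i0 i1.
  rewrite !eqxx !mul1r (_ : (i0 == i1) = false)// mul0r => h01 h11 h00.
  rewrite -{1}h11 -h00.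
  have -> : s * (f i1 * f i1) * (s * (f i0 * f i0)) =
    (s * (f i0 * f i1)) ^+ 2 by ring.
  by rewrite h01 expr0n.
have tA b d : tau b d = A b d by rewrite tauE m0 !mul0r addr0.
have gA d : \sum_a A d a * f a = - (c * phi * f d).
  have := gr d; under eq_bigr do rewrite tA.
  rewrite !sum3E (symA i0 d) (symA i1 d) (symA i2 d); lra.
have g := gA i0; have g1 := gA i1; have g2 := gA i2.
have := tr; move: g g1 g2; rewrite !sum3E => g g1 g2 tr'.
have h a b : phi ^+ 2 * (A a i0 * A b i0 + A a i1 * A b i1 + A a i2 * A b i2)
   = (a == b)%:R - f a * f b by rewrite -hS sum3E; ring.
have [|||||||||||] := @sym3_grad0 R (phi * A i0 i0) (phi * A i0 i1)
  (phi * A i0 i2) (phi * A i1 i1) (phi * A i1 i2) (phi * A i2 i2)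
  (f i0) (f i1) (f i2) (c * phi ^+ 2).
- by rewrite mulr_gt0// exprn_gt0.
- by rewrite -!mulrDr tr'; ring.
- have := h i0 i0; rewrite /= => <-; ring.
- have := h i0 i1; rewrite /= sub0r => <-; rewrite (symA i1 i0); ring.
- have := h i0 i2; rewrite /= sub0r => <-; rewrite (symA i2 i0) (symA i2 i1); ring.
- have := h i1 i1; rewrite /= => <-; rewrite (symA i1 i0); ring.
- have := h i1 i2; rewrite /= sub0r => <-.
  rewrite (symA i2 i0) (symA i2 i1) (symA i1 i0); ring.
- have := h i2 i2; rewrite /= => <-; rewrite (symA i2 i0) (symA i2 i1); ring.
- by rewrite -!mulrA -!mulrDr g; ring.
- by rewrite (symA i0 i1) -!mulrA -!mulrDr g1; ring.
- by rewrite (symA i0 i2) (symA i1 i2) -!mulrA -!mulrDr g2; ring.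
- by move=> ? ? ?; exact: forall3.
Qed.

End shape_algebra.

(** * The two immersions at a point *)

(* Values at one point, in an orthonormal frame [v_a]: [E a], [y1 a] are the
   derivatives of [x] and [y] along [v_a], and [F2 a b], [y2 a b] the second
   derivatives. Below [y = phi N] with [N] a unit normal of [x], [A] is the shape
   operator for [- N], [B = phi A] and [f = d phi]. *)
Section pointwise.
Variables (R : realType) (c : R) (y : 'rV[R]_4).
Variables (E y1 : 'I_3 -> 'rV[R]_4) (F2 y2 : 'I_3 -> 'I_3 -> 'rV[R]_4).
Hypothesis c_gt0 : 0 < c.
Hypothesis hE : forall a b, dot (E a) (E b) = (a == b)%:R.
Hypothesis hyE : forall a, dot y (E a) = 0.
Hypothesis hy1E : forall a b, dot (y1 b) (E a) = - dot y (F2 a b).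
Hypothesis F2C : forall a b, F2 a b = F2 b a.
Hypothesis y2C : forall a b, y2 a b = y2 b a.
Hypothesis hy1 : forall a b, dot (y1 a) (y1 b) = (a == b)%:R.
Hypothesis koszul : forall a b d, dot (y2 a b) (y1 d) = dot (F2 a b) (E d).
Hypothesis codazzi : forall a b d,
  dot (y2 b d) (E a) + dot (y1 b) (F2 a d) =
  dot (y2 a d) (E b) + dot (y1 a) (F2 b d).
Hypothesis gauss : forall a b d e,
  dot (F2 a b) (F2 d e) - dot (F2 a e) (F2 d b) =
  dot (y2 a b) (y2 d e) - dot (y2 a e) (y2 d b).
Hypothesis trace : \sum_a dot (y1 a) (E a) = c * dot y y.
Hypothesis dtrace : forall d,
  \sum_a (dot (y2 a d) (E a) + dot (y1 a) (F2 a d)) -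
  \sum_a \sum_b (dot (F2 a d) (E b) + dot (E a) (F2 b d)) * dot (y1 a) (E b) =
  2 * c * dot y (y1 d).

Let phi := Num.sqrt (dot y y).
Let N := phi^-1 *: y.
Let B a b := dot (y1 a) (E b).
Let A a b := - dot (F2 a b) N.
Let f a := dot (y1 a) N.
Let G a b d := dot (F2 a b) (E d).

(** If [y = 0], every [y1 a] is orthogonal to all [E b]. Taking [y1 i0] as the unit normal of the
    frame [E], the vector [y1 i1] has no component at all, although its length is one. *)
Lemma pos_neq0 : y != 0.
Proof.
apply/eqP => y0.
have B0 a b : dot (y1 a) (E b) = 0 by rewrite hy1E y0 dot0l oppr0.
have EN b : dot (E b) (y1 i0) = 0 by rewrite dotC B0.
have := dot_frame (y1 i1) (y1 i1) hE EN (hy1 _ _).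
rewrite big1 => [|b _]; last by rewrite B0 mul0r.
by rewrite !hy1 !eqxx (_ : (i1 == i0) = false)// mul0r addr0 => /eqP; rewrite oner_eq0.
Qed.

Let phi_gt0 : 0 < phi.
Proof. by rewrite sqrtr_gt0 dot_gt0 pos_neq0. Qed.

Let phi2 : phi ^+ 2 = dot y y.
Proof. by rewrite sqr_sqrtr// dot_ge0. Qed.

Let yN : y = phi *: N.
Proof. by rewrite scalerA mulfV ?scale1r// gt_eqF. Qed.

Let NE a : dot (E a) N = 0.
Proof. by rewrite dotZr dotC hyE mulr0. Qed.

Let NN : dot N N = 1.
Proof.
have p0 : phi != 0 by rewrite gt_eqF.
by rewrite dotZl dotZr -phi2; field.
Qed.

Let BA a b : B a b = phi * A a b.
Proof. by rewrite /B /A hy1E F2C {1}yN dotZl dotC mulrN. Qed.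

Let symA a b : A a b = A b a. Proof. by rewrite /A F2C. Qed.

Let symB a b : B a b = B b a. Proof. by rewrite !BA symA. Qed.

Let pf u v : dot u v = \sum_a dot u (E a) * dot v (E a) + dot u N * dot v N.
Proof. exact: dot_frame. Qed.

Let BBff a b : \sum_d B a d * B b d + f a * f b = (a == b)%:R.
Proof. by rewrite -hy1 [in RHS]pf. Qed.

Let yy1 a : dot y (y1 a) = phi * f a.
Proof. by rewrite {1}yN dotZl dotC. Qed.

Section normal_of_y.
Variable sigma : R.
Hypothesis Bf : forall a, \sum_b B a b * f b = sigma * f a.
Hypothesis sigma2 : sigma ^+ 2 + \sum_a f a * f a = 1.

(* [n] is a unit normal of [y]: orthogonality to [y1 a] is [B f = sigma f]. *)
Let n := sigma *: N - \sum_a f a *: E a.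
Let tau a b := dot (y2 a b) n.

Let En a : dot (E a) n = - f a.
Proof.
rewrite dotBr dotZr NE mulr0 sub0r dot_sumr (bigD1 a)//= dotZr hE eqxx mulr1.
by rewrite big1 ?addr0// => b ba; rewrite dotZr hE eq_sym (negPf ba) mulr0.
Qed.

Let Nn : dot N n = sigma.
Proof.
rewrite dotBr dotZr NN mulr1 dot_sumr big1 ?subr0// => b _.
by rewrite dotZr dotC NE mulr0.
Qed.

Let y1n a : dot (y1 a) n = 0.
Proof.
rewrite dotBr dotZr dot_sumr -[dot (y1 a) N]/(f a) -Bf; apply/eqP.
rewrite subr_eq0; apply/eqP/eq_bigr => b _.
by rewrite dotZr mulrC.
Qed.

Let nn : dot n n = 1.
Proof.
rewrite pf [dot n N]dotC Nn -sigma2 addrC expr2; congr (_ + _).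
by apply: eq_bigr => a _; rewrite [dot n _]dotC En mulrNN.
Qed.

Let pf' u v : dot u v = \sum_a dot u (y1 a) * dot v (y1 a) + dot u n * dot v n.
Proof. exact: dot_frame. Qed.

(** Expansion in the frame [y1], [n] adapted to [y]: by [koszul] the components of [y2 i j] along
    [y1] are those of [F2 i j] along [E], namely [G i j]. *)
Let y2E i j k : dot (y2 i j) (E k) = \sum_e G i j e * B e k - tau i j * f k.
Proof.
rewrite pf' En mulrN; congr (_ - _); apply: eq_bigr => e _.
by rewrite koszul [dot (E k) _]dotC.
Qed.

Let y1F i j k : dot (y1 i) (F2 j k) = \sum_e B i e * G j k e - f i * A j k.
Proof. by rewrite pf /A mulrN opprK. Qed.

(** By symmetry of [B] the terms in [G] agree on both sides of [codazzi]; only the normal components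
    are left. *)
Lemma codazzi_scalar a b d :
  (tau b d - A b d) * f a = (tau a d - A a d) * f b.
Proof.
have := codazzi a b d; rewrite !y2E !y1F !sum3E.
rewrite (symB _ a) (symB _ b) (symB i2 a) (symB i1 a) (symB i2 b) (symB i1 b).
lra.
Qed.

(** Both immersions contribute the same tangential products of [G], which cancel. *)
Lemma gauss_scalar a b d e :
  A a b * A d e - A a e * A d b = tau a b * tau d e - tau a e * tau d b.
Proof.
have FF i j k l : dot (F2 i j) (F2 k l) =
    \sum_e G i j e * G k l e + A i j * A k l by rewrite pf mulrNN.
have YY i j k l : dot (y2 i j) (y2 k l) =
    \sum_e G i j e * G k l e + tau i j * tau k l.
  by rewrite pf'; congr (_ + _); apply: eq_bigr => m _; rewrite !koszul.
have := gauss a b d e; rewrite !FF !YY; lra.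
Qed.

(** The subtracted sum, due to the derivative of the inverse metric, cancels exactly the terms in
    [G]. *)
Lemma dtrace_scalar d :
  \sum_a f a * (tau a d + A a d) = - (2 * c * phi * f d).
Proof.
have := dtrace d; rewrite yy1.
have -> : \sum_a (dot (y2 a d) (E a) + dot (y1 a) (F2 a d)) =
  \sum_a (\sum_e G a d e * B e a - tau a d * f a +
    (\sum_e B a e * G a d e - f a * A a d)).
  by apply: eq_bigr => a _; rewrite y2E y1F.
have -> : \sum_a \sum_b (dot (F2 a d) (E b) + dot (E a) (F2 b d)) * dot (y1 a) (E b)
  = \sum_a \sum_b (G a d b + G b d a) * B a b.
  by apply: eq_bigr => a _; apply: eq_bigr => b _; rewrite [dot (E a) _]dotC.
rewrite !sum3E (symB i1 i0) (symB i2 i0) (symB i2 i1); lra.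
Qed.

End normal_of_y.

Lemma pointwise_grad0 a : dot y (y1 a) = 0.
Proof.
rewrite yy1; suff -> : f a = 0 by rewrite mulr0.
pose Phi := \sum_a f a * f a.
have [Phi0|Phin0] := eqVneq Phi 0.
  have /psumr_eq0P : \sum_a f a ^+ 2 = 0.
    by rewrite -[RHS]Phi0; apply: eq_bigr => ? _; rewrite expr2.
  by move=> H; apply/eqP; rewrite -sqrf_eq0 H// => i _; exact: sqr_ge0.
pose g b := \sum_d B b d * f d.
(* B^3 is symmetric. Replacing one B^2 by 1 - f f^T leaves B - g f^T, so g f^T is symmetric and [g]
   is parallel to [f]. *)
have gf b d : g b * f d = g d * f b.
  have comm : \sum_e B b e * (\sum_k B d k * B e k) =
              \sum_e B d e * (\sum_k B b k * B e k).
    rewrite !sum3E (symB i1 i0) (symB i2 i0) (symB i2 i1); ring.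
  move: comm.
  have BB i j : \sum_k B i k * B j k = (i == j)%:R - f i * f j.
    by rewrite -BBff addrK.
  under eq_bigr do rewrite BB; under [in RHS]eq_bigr do rewrite BB.
  have dl i j : \sum_e B i e * ((j == e)%:R - f j * f e) = B i j - g i * f j.
    rewrite /g mulr_suml; under eq_bigr do rewrite mulrBr.
    rewrite sumrB (bigD1 j)//= eqxx mulr1 big1 => [|e ej]; last first.
      by rewrite eq_sym (negPf ej) mulr0.
    by rewrite addr0; congr (_ - _); apply: eq_bigr => e _; ring.
  rewrite !dl symB => /addrI/oppr_inj; exact.
pose sigma := (\sum_b g b * f b) / Phi.
have Bf b : \sum_d B b d * f d = sigma * f b.
  apply: (mulIf Phin0); rewrite -[\sum_d _]/(g b) /sigma.
  have -> : (\sum_b g b * f b) / Phi * f b * Phi = (\sum_b g b * f b) * f b.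
    by field.
  rewrite /Phi mulr_sumr mulr_suml; apply: eq_bigr => d _.
  by rewrite mulrA gf; ring.
have s2 : sigma ^+ 2 + \sum_a f a * f a = 1.
  have e b : sigma ^+ 2 * f b = f b * (1 - Phi).
    have -> : sigma ^+ 2 * f b = \sum_k (\sum_d B b d * B k d) * f k.
      rewrite expr2 -mulrA -Bf mulr_sumr.
      have -> : \sum_d sigma * (B b d * f d) = \sum_d B b d * \sum_k B d k * f k.
        by apply: eq_bigr => d _; rewrite Bf; ring.
      rewrite !sum3E (symB i1 i0) (symB i2 i0) (symB i2 i1); ring.
    have -> : \sum_k (\sum_d B b d * B k d) * f k =
        \sum_k ((b == k)%:R * f k - f b * (f k * f k)).
      by apply: eq_bigr => k _; rewrite -BBff; ring.
    rewrite sumrB -mulr_sumr -/Phi (bigD1 b)//= eqxx mul1r big1 => [|k kb].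
      by ring.
    by rewrite eq_sym (negPf kb) mul0r.
  apply: (mulIf Phin0); rewrite mul1r mulrDl -/Phi.
  have -> : sigma ^+ 2 * Phi = Phi * (1 - Phi).
    rewrite {1}/Phi mulr_sumr [RHS]mulr_suml; apply: eq_bigr => b _.
    by rewrite mulrA e; ring.
  by ring.
apply: (@shape_grad0 R A (fun a b => dot (y2 a b) (sigma *: N - \sum_a f a *: E a))
  f phi c sigma) => //.
- by move=> ? ?; rewrite y2C.
- move=> i j; rewrite -BBff; congr (_ + _); rewrite mulr_sumr.
  by apply: eq_bigr => d _; rewrite !BA; ring.
- move=> i; rewrite -Bf mulr_sumr; apply: eq_bigr => d _; rewrite BA; ring.
- exact: codazzi_scalar.
- exact: gauss_scalar.
- apply: (mulfI (lt0r_neq0 phi_gt0)); rewrite mulr_sumr.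
  rewrite [RHS]mulrCA -expr2 phi2 -trace; apply: eq_bigr => i _.
  by rewrite -BA.
- exact: dtrace_scalar.
Qed.

(** Available only after [pointwise_grad0] has been applied at all points of an open set: it is the
    derivative of [dot y (y1 b) = 0]. *)
Hypothesis hess0 : forall a b, dot y (y2 a b) + dot (y1 a) (y1 b) = 0.

Lemma pointwise_rigid : (forall a, y1 a = E a) /\ c * dot y y = 3.
Proof.
have f0 a : f a = 0.
  apply: (mulfI (lt0r_neq0 phi_gt0)).
  by rewrite mulr0 -yy1 pointwise_grad0.
have Bf a : \sum_b B a b * f b = 1 * f a.
  by rewrite f0 mulr0 big1// => b _; rewrite f0 mulr0.
have s2 : 1 ^+ 2 + \sum_a f a * f a = 1 :> R.
  by rewrite expr1n big1 ?addr0// => b _; rewrite f0 mulr0.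
have nE : 1 *: N - \sum_a f a *: E a = N.
  by rewrite scale1r big1 ?subr0// => b _; rewrite f0 scale0r.
have G' := gauss_scalar Bf s2; rewrite nE in G'.
have tauE a b : phi * dot (y2 a b) N = - (a == b)%:R.
  have := hess0 a b; rewrite hy1 {1}yN dotZl dotC => /eqP.
  by rewrite addr_eq0 => /eqP.
have BB a b : \sum_d B a d * B b d = (a == b)%:R.
  by rewrite -BBff f0 mul0r addr0.
have GB a b d e : B a b * B d e - B a e * B d b =
    (a == b)%:R * (d == e)%:R - (a == e)%:R * (d == b)%:R.
  rewrite !BA; have := G' a b d e.
  have -> : phi * A a b * (phi * A d e) - phi * A a e * (phi * A d b) =
    phi ^+ 2 * (A a b * A d e - A a e * A d b) by ring.
  move=> ->; rewrite -[(a == b)%:R]opprK -tauE -[(d == e)%:R]opprK -tauE.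
  rewrite -[(a == e)%:R]opprK -tauE -[(d == b)%:R]opprK -tauE; ring.
pose t := \sum_a B a a.
have tE : t = c * phi ^+ 2 by rewrite phi2 -trace.
(* Contraction of the Gauss identity [GB]: in dimension three its right-hand side contributes 3 - 1,
   and B^2 = 1 adds the missing 1. *)
have tB : forall a b, t * B a b = 3 * (a == b)%:R.
  have st a b : t * B a b = \sum_d (B a b * B d d - B a d * B d b) + \sum_d B a d * B b d.
    rewrite /t mulr_suml -big_split; apply: eq_bigr => d _ /=.
    by rewrite (symB b d); ring.
  move=> a b; rewrite st BB; under eq_bigr do rewrite GB eqxx mulr1.
  move: a b; apply: forall3; apply: forall3; rewrite sum3E /=; ring.
have t0 : 0 < t by rewrite tE mulr_gt0// exprn_gt0.
have BE a b : B a b = 3 / t * (a == b)%:R.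
  by apply: (mulfI (lt0r_neq0 t0)); rewrite tB; field; exact: lt0r_neq0.
(* B^2 = 1 gives 3 / t = 1 or -1, and [t] is positive. *)
have t3 : t = 3.
  have := BB i0 i0; rewrite sum3E !BE /= => h.
  have : (3 / t) ^+ 2 = 1 by rewrite -[RHS]h; ring.
  move/eqP; rewrite sqrf_eq1 => /orP[|] /eqP h3.
    by have := congr1 (fun z => z * t) h3; rewrite mul1r divfK ?lt0r_neq0// => <-.
  have : 0 < 3 / t by rewrite divr_gt0.
  by rewrite h3 oppr_gt0 ltr10.
split=> [a|]; last by rewrite -phi2 -tE.
apply: eq_dot => w; rewrite pf -[dot (y1 a) N]/(f a) f0 mul0r addr0.
rewrite (bigD1 a)//= big1 => [|b ba].
  by rewrite -[dot (y1 a) _]/(B a a) BE t3 eqxx divff// !mul1r addr0 dotC.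
by rewrite -[dot (y1 a) _]/(B a b) BE eq_sym (negPf ba) mulr0 mul0r.
Qed.

End pointwise.

(** * Orthonormal frames and Gram matrices *)

Section linear_algebra.
Variable R : realType.

Lemma unitmx_inj n (A : 'M[R]_n) :
  (forall x : 'rV_n, x *m A = 0 -> x = 0) -> A \in unitmx.
Proof.
move=> A0; rewrite -row_free_unit -kermx_eq0; apply/rowV0P => x.
by move=> /sub_kermxP; exact: A0.
Qed.

(** The trace of a bilinear form with respect to a metric does not depend on the basis. It serves
    both the passage to a frame and the change of charts. *)
Lemma mxtrace_congr n (V g b : 'M[R]_n) : V \in unitmx -> g \in unitmx ->
  \tr (invmx (V *m g *m V^T) *m (V *m b *m V^T)) = \tr (invmx g *m b).
Proof.
move=> uV ug; have uVT : V^T \in unitmx by rewrite unitmx_tr.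
have -> : invmx (V *m g *m V^T) = invmx V^T *m invmx g *m invmx V.
  apply: (can_inj (mulKmx (_ : V *m g *m V^T \in unitmx))); rewrite ?unitmx_mul ?uV ?ug//.
  rewrite mulmxV ?unitmx_mul ?uV ?ug// -!mulmxA mulKVmx// !mulmxA.
  by rewrite mulmxK// mulmxV.
rewrite -!mulmxA mulKmx// mxtrace_mulC -!mulmxA mulmxV// mulmx1.
by rewrite mxtrace_mulC.
Qed.

(** Gram-Schmidt for the inner product pulled back by [L]. A rank count supplies a vector outside
    the span of those already built, and injectivity of [L] keeps its corrected image nonzero. *)
Lemma orthonormal_frame n m (L : {linear 'rV[R]_n -> 'rV[R]_m}) :
  (forall v, L v = 0 -> v = 0) ->
  exists v : 'I_n -> 'rV[R]_n, forall a b, dot (L (v a)) (L (v b)) = (a == b)%:R.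
Proof.
move=> L0.
suff H k : (k <= n)%N -> exists v : 'I_k -> 'rV[R]_n,
    forall a b, dot (L (v a)) (L (v b)) = (a == b)%:R by exact: H.
elim: k => [|k IH] kn; first by exists (fun=> 0) => -[].
have [v hv] := IH (ltnW kn).
pose V : 'M[R]_(k, n) := \matrix_a v a.
have [w wV] : exists w : 'rV[R]_n, ~~ (w <= V)%MS.
  have : ~~ ((1%:M : 'M[R]_n) <= V)%MS.
    rewrite sub1mx /row_full neq_ltn (leq_ltn_trans (rank_leq_row V))//.
  by case/row_subPn => i; exists (row i 1%:M).
pose z := w - \sum_a dot (L w) (L (v a)) *: v a.
have Lz : L z = L w - \sum_a dot (L w) (L (v a)) *: L (v a).
  by rewrite linearB linear_sum; congr (_ - _); apply: eq_bigr => a _; rewrite linearZ.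
have zv a : dot (L z) (L (v a)) = 0.
  rewrite Lz dotBl dot_suml (bigD1 a)//= dotZl hv eqxx mulr1 big1 ?addr0 ?subrr//.
  by move=> b ba; rewrite dotZl hv (negPf ba) mulr0.
have Lz0 : L z != 0.
  apply: contra wV => /eqP/L0/eqP; rewrite subr_eq0 => /eqP ->.
  apply: summx_sub => a _; apply: scalemx_sub.
  by rewrite (_ : v a = row a V) ?row_sub// rowK.
have r0 : 0 < Num.sqrt (dot (L z) (L z)) by rewrite sqrtr_gt0 dot_gt0.
have rr : Num.sqrt (dot (L z) (L z)) ^+ 2 = dot (L z) (L z).
  by rewrite sqr_sqrtr// dot_ge0.
move: (Num.sqrt _) r0 rr => r r0 rr.
exists (fun i => if unlift ord_max i is Some a then v a else r^-1 *: z) => i j.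
case: unliftP => [a|] ->; case: unliftP => [b|] ->.
- by rewrite hv (inj_eq lift_inj).
- by rewrite linearZ dotZr dotC zv mulr0 eq_sym (negPf (neq_lift _ _)).
- by rewrite linearZ dotZl zv mulr0 (negPf (neq_lift _ _)).
- by rewrite linearZ dotZl dotZr -rr eqxx (_ : true%:R = 1 :> R)//; field; exact: lt0r_neq0.
Qed.

(** The product is bracketed so that the frame matrix is its left factor: its invertibility and a
    left inverse of [L] can both be read off. *)
Lemma orthonormal_frame_mx n m (L : {linear 'rV[R]_n -> 'rV[R]_m})
    (v : 'I_n -> 'rV[R]_n) :
  (forall a b, dot (L (v a)) (L (v b)) = (a == b)%:R) ->
  (\matrix_a v a) *m (lin1_mx L *m ((\matrix_a v a) *m lin1_mx L)^T) = 1%:M.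
Proof.
move=> hv; rewrite mulmxA; set W := _ *m lin1_mx L.
have WE a i : W a i = L (v a) 0 i.
  have -> : L (v a) = row a W by rewrite row_mul rowK mul_rV_lin1.
  by rewrite [RHS]mxE.
apply/matrixP => a b; rewrite mxE [RHS]mxE -hv; apply: eq_bigr => i _.
by rewrite [W^T _ _]mxE !WE.
Qed.

Lemma frame_unitmx n m (L : {linear 'rV[R]_n -> 'rV[R]_m}) (v : 'I_n -> 'rV[R]_n) :
  (forall a b, dot (L (v a)) (L (v b)) = (a == b)%:R) ->
  (\matrix_a v a) \in unitmx.
Proof. by move=> /orthonormal_frame_mx/mulmx1_unit[]. Qed.

Lemma linear_left_inverse n m (L : {linear 'rV[R]_n -> 'rV[R]_m}) :
  (forall v, L v = 0 -> v = 0) -> exists P : 'M[R]_(m, n), forall v, L v *m P = v.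
Proof.
move=> /orthonormal_frame[v hv]; have := orthonormal_frame_mx hv.
set V := \matrix_a v a => /mulmx1C; rewrite -mulmxA => E.
by exists ((V *m lin1_mx L)^T *m V) => w; rewrite -(mul_rV_lin1 L) -mulmxA E mulmx1.
Qed.

End linear_algebra.

Section gram.
Variables (R : realType) (n m : nat).
Implicit Types (U : set 'rV[R]_n) (F Y : 'rV[R]_n -> 'rV[R]_m).

Definition gram F (v : 'I_n -> 'rV[R]_n) u : 'M[R]_n :=
  \matrix_(a, b) dot (pd (v a) F u) (pd (v b) F u).

(** For [N] normal to [F] at [u] this is the second fundamental form in direction [N], the
    Christoffel terms being tangential. *)
Definition hess F (v : 'I_n -> 'rV[R]_n) (N : 'rV[R]_m) u : 'M[R]_n :=
  \matrix_(a, b) dot (pd (v a) (pd (v b) F) u) N.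

Lemma gram_congr F (v : 'I_n -> 'rV[R]_n) u : differentiable F u ->
  gram F v u = (\matrix_a v a) *m gram F (@basis_vec R n) u *m (\matrix_a v a)^T.
Proof.
move=> dF; apply/matrixP => a b.
rewrite mxE [RHS]mxE !pdE (derive_rV_sum (v a) dF) (derive_rV_sum (v b) dF).
rewrite dot_sumr; apply: eq_bigr => j _; rewrite dotZr dot_suml mulrC !mxE.
by congr (_ * _); apply: eq_bigr => i _; rewrite dotZl !mxE !pdE.
Qed.

(** The vectors [v a] are constant, so no derivative of the frame appears. *)
Lemma hess_congr U F (v : 'I_n -> 'rV[R]_n) N u : open U -> U u ->
  smooth_on U F ->
  hess F v N u = (\matrix_a v a) *m hess F (@basis_vec R n) N u *m (\matrix_a v a)^T.
Proof.
move=> oU Uu sF; apply/matrixP => a b; rewrite mxE [RHS]mxE !pdE.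
have sDF w := smooth_on_derive w sF.
have E w z : 'D_w ('D_z F) u = \sum_j z 0 j *: 'D_w ('D_(basis_vec R j) F) u.
  have -> : 'D_w ('D_z F) u =
      'D_w (\sum_j z 0 j *: 'D_(basis_vec R j) F) u.
    apply: near_eq_derive; apply: near_open oU Uu _ => y Uy.
    by rewrite (derive_rV_sum z (smooth_on_differentiable sF Uy)) fct_sumE.
  rewrite derive_sum => [|j]; last first.
    by apply: derivableZ; exact: smooth_on_derivable (sDF _) Uu.
  by apply: eq_bigr => j _; rewrite deriveZ//; exact: smooth_on_derivable (sDF _) Uu.
rewrite E dot_suml; apply: eq_bigr => j _; rewrite dotZl mulrC.
rewrite (derive_rV_sum (v a) (smooth_on_differentiable (sDF _) Uu)) dot_suml.
by rewrite !mxE; congr (_ * _); apply: eq_bigr => i _; rewrite dotZl !mxE !pdE.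
Qed.

Lemma gram_unit F (v : 'I_n -> 'rV[R]_n) u : differentiable F u ->
  (forall w, pd w F u = 0 -> w = 0) -> (\matrix_a v a) \in unitmx ->
  gram F v u \in unitmx.
Proof.
move=> dF F0 uV; apply: unitmx_inj => x xg.
suff : x *m (\matrix_a v a) = 0.
  by move=> h; rewrite -[x](mulmxK uV) h mul0mx.
apply: F0; rewrite mulmx_sum_row pd_lin//; apply/eqP; rewrite -dot_eq0.
rewrite dot_sumr big1// => b _; rewrite dotZr dot_suml.
have := congr1 (fun y : 'rV_n => y 0 b) xg; rewrite !mxE => h.
rewrite rowK (_ : \sum_i _ = 0) ?mulr0// -[RHS]h.
by apply: eq_bigr => i _; rewrite dotZl rowK mxE.
Qed.

Lemma pd_frame F p : differentiable F p ->
  (forall w, pd w F p = 0 -> w = 0) ->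
  exists2 v : 'I_n -> 'rV[R]_n,
    (forall a b, dot (pd (v a) F p) (pd (v b) F p) = (a == b)%:R) &
    (\matrix_a v a) \in unitmx.
Proof.
move=> dF F0; have [w dFw|v hv] := @orthonormal_frame R n m ('d F p).
  by apply: F0; rewrite pdE deriveE.
by exists v; [move=> a b; rewrite !pdE !deriveE|exact: (frame_unitmx hv)].
Qed.

Lemma basis_unitmx : (\matrix_a basis_vec R a : 'M[R]_n) \in unitmx.
Proof.
rewrite (_ : \matrix_a _ = 1%:M) ?unitmx1//.
by apply/matrixP => i j; rewrite !mxE eqxx eq_sym.
Qed.

Lemma Ck_dot U F Y k : open U -> smooth_on U F -> smooth_on U Y ->
  Ck k U (fun u => dot (F u) (Y u)).
Proof.
move=> oU /(smooth_on_coord _ oU) sF /(smooth_on_coord _ oU) sY.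
by apply: Ck_sum => // i; exact: CkM.
Qed.

Lemma Ck_invgram U F (v : 'I_n -> 'rV[R]_n) k a b : open U -> smooth_on U F ->
  (forall u, U u -> gram F v u \in unitmx) ->
  Ck k U (fun u => invmx (gram F v u) a b).
Proof.
move=> oU sF uG; apply: Ck_invmx => // i j.
by under eq_fun do rewrite mxE; apply: Ck_dot => //; exact: smooth_pd.
Qed.

End gram.

(** In codimension one the normal space is a line. *)
Lemma normal_line (R : realType) k (F : 'rV[R]_k -> 'rV[R]_k.+1) p
    (N d : 'rV[R]_k.+1) : differentiable F p ->
  (forall w, pd w F p = 0 -> w = 0) -> N != 0 ->
  (forall w, dot N (pd w F p) = 0) -> (forall w, dot d (pd w F p) = 0) ->
  d = (dot d N / dot N N) *: N.
Proof.
move=> dF F0 N0 NF dN; have [v hv _] := pd_frame dF F0.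
have n0 : 0 < Num.sqrt (dot N N) by rewrite sqrtr_gt0 dot_gt0.
have n2 : Num.sqrt (dot N N) ^+ 2 = dot N N by rewrite sqr_sqrtr// dot_ge0.
move: (Num.sqrt _) n0 n2 => r r0 r2; have rn0 := lt0r_neq0 r0.
apply: eq_dot => w; rewrite (@dot_frame _ _ (fun a => pd (v a) F p) (r^-1 *: N))//.
- rewrite big1 ?add0r => [|a _]; last by rewrite dN mul0r.
  by rewrite !dotZr dotZl (dotC w) -r2; field.
- by move=> a; rewrite dotZr dotC NF mulr0.
- by rewrite dotZl dotZr -r2; field.
Qed.

(** * Rigidity in a chart *)

Section local_rigidity.
Variables (R : realType) (U : set 'rV[R]_3) (F Y : 'rV[R]_3 -> 'rV[R]_4) (c : R).
Hypothesis oU : open U.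
Hypothesis c_gt0 : 0 < c.
Hypothesis sF : smooth_on U F.
Hypothesis sY : smooth_on U Y.
Hypothesis F_inj : forall u w, U u -> pd w F u = 0 -> w = 0.
Hypothesis Y_normal : forall u w, U u -> dot (Y u) (pd w F u) = 0.
Hypothesis Y_isom : forall u v w, U u ->
  dot (pd v Y u) (pd w Y u) = dot (pd v F u) (pd w F u).
(** The equation Delta x = c y paired with y; the sign is that of Delta as minus a trace. *)
Hypothesis Y_trace : forall u, U u ->
  \tr (invmx (gram F (@basis_vec R 3) u) *m hess F (@basis_vec R 3) (Y u) u) =
  - (c * dot (Y u) (Y u)).

Let sDF v : smooth_on U (pd v F). Proof. exact: smooth_pd. Qed.
Let sDY v : smooth_on U (pd v Y). Proof. exact: smooth_pd. Qed.
Let sDDF v w : smooth_on U (pd v (pd w F)). Proof. exact: smooth_pd. Qed.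
Let sDDY v w : smooth_on U (pd v (pd w Y)). Proof. exact: smooth_pd. Qed.

Let DFC u v w : U u -> pd v (pd w F) u = pd w (pd v F) u.
Proof. by move=> Uu; apply: pdC oU Uu sF. Qed.
Let DYC u v w : U u -> pd v (pd w Y) u = pd w (pd v Y) u.
Proof. by move=> Uu; apply: pdC oU Uu sY. Qed.

Lemma second_form_Y u a b : U u ->
  dot (pd b Y u) (pd a F u) = - dot (Y u) (pd a (pd b F) u).
Proof.
move=> Uu; have := @derive_dot_eq R 3 4 U Y (pd a F) (fun=> 0) (fun=> 0) u b.
have s0 : smooth_on U (fun=> 0 : 'rV[R]_4).
  exact: smooth_on_cst.
move=> /(_ oU Uu sY (sDF a) s0 s0) H.
have /eqP : dot (pd b Y u) (pd a F u) + dot (Y u) (pd b (pd a F) u) = 0.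
  rewrite H => [|z Uz]; last by rewrite (Y_normal a Uz) dot0l.
  by rewrite dot0l dot0r addr0.
by rewrite addr_eq0 (DFC b a Uu) => /eqP.
Qed.

(** The Koszul argument: the difference [K] is symmetric in its first two arguments and, by the
    derivative of [Y_isom], antisymmetric in its last two. Such a form vanishes. *)
Lemma koszul_Y u a b d : U u ->
  dot (pd a (pd b Y) u) (pd d Y u) = dot (pd a (pd b F) u) (pd d F u).
Proof.
move=> Uu; pose K x y z := dot (pd x (pd y Y) u) (pd z Y u) -
  dot (pd x (pd y F) u) (pd z F u).
have K1 x y z : K x y z = K y x z by rewrite /K (DFC x y Uu) (DYC x y Uu).
have K2 x y z : K x y z = - K x z y.
  have := @derive_dot_eq R 3 4 U (pd y Y) (pd z Y) (pd y F) (pd z F) u x oU Uu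
    (sDY y) (sDY z) (sDF y) (sDF z) (fun u => @Y_isom u y z).
  rewrite (dotC (pd y Y u)) (dotC (pd y F u)) /K; lra.
suff : K a b d = 0 by move/eqP; rewrite subr_eq0 => /eqP.
have : K a b d = - K a b d.
  by rewrite {1}K2 K1 K2 opprK K1 K2 K1.
lra.
Qed.

(** Derivative along [d] of the symmetry in [a] and [b] of [dot (pd b Y u) (pd a F u)], which holds
    by [second_form_Y]. *)
Lemma codazzi_Y u a b d : U u ->
  dot (pd b (pd d Y) u) (pd a F u) + dot (pd b Y u) (pd a (pd d F) u) =
  dot (pd a (pd d Y) u) (pd b F u) + dot (pd a Y u) (pd b (pd d F) u).
Proof.
move=> Uu; rewrite (DYC b d Uu) (DYC a d Uu) (DFC a d Uu) (DFC b d Uu).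
apply: (@derive_dot_eq R 3 4 U (pd b Y) (pd a F) (pd a Y) (pd b F) u d oU Uu
  (sDY b) (sDF a) (sDY a) (sDF b)) => z Uz.
by rewrite (second_form_Y a b Uz) (second_form_Y b a Uz) (DFC a b Uz).
Qed.

(** Differentiate [koszul_Y] in two ways that exchange [b] and [e], and subtract: the third
    derivatives drop out by symmetry. Both sides are curvature expressions of the common metric. *)
Lemma gauss_Y u a b d e : U u ->
  dot (pd a (pd b F) u) (pd d (pd e F) u) - dot (pd a (pd e F) u) (pd d (pd b F) u) =
  dot (pd a (pd b Y) u) (pd d (pd e Y) u) - dot (pd a (pd e Y) u) (pd d (pd b Y) u).
Proof.
move=> Uu.
have H (x z : 'rV[R]_3) := @derive_dot_eq R 3 4 U (pd a (pd x Y)) (pd d Y)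
    (pd a (pd x F)) (pd d F) u z oU Uu
    (sDDY a x) (sDY d) (sDDF a x) (sDF d) (fun u => @koszul_Y u a x d).
have third (G : 'rV[R]_3 -> 'rV[R]_4) x y z : smooth_on U G ->
    pd z (pd x (pd y G)) u = pd y (pd x (pd z G)) u.
  move=> sG; have sDG w : smooth_on U (pd w G) by exact: smooth_pd.
  rewrite (pdC _ _ oU Uu (sDG _)) [RHS](pdC _ _ oU Uu (sDG _)).
  apply: eq_pd oU Uu _ => w Uw.
  exact: pdC oU Uw sG.
have := H b e; have := H e b.
rewrite (third Y a e b sY) (third F a e b sF).
rewrite (DFC d e Uu) (DFC d b Uu) (DYC d e Uu) (DYC d b Uu); lra.
Qed.

Section frame_at_point.
Variables (p : 'rV[R]_3) (v : 'I_3 -> 'rV[R]_3).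
Hypothesis Up : U p.
Hypothesis hv : forall a b, dot (pd (v a) F p) (pd (v b) F p) = (a == b)%:R.
Hypothesis uv : (\matrix_a v a) \in unitmx.

(** The frame is orthonormal at [p] only, so the inverse metric is kept at nearby points; it is the
    identity at [p], but its derivative there need not vanish. *)
Let M u a b := invmx (gram F v u) a b.
Let beta u a b := dot (pd (v a) Y u) (pd (v b) F u).

Let uG u : U u -> gram F v u \in unitmx.
Proof.
move=> Uu; apply: gram_unit => //; first exact: smooth_on_differentiable Uu.
by move=> w; exact: F_inj.
Qed.

Let ug u : U u -> gram F (@basis_vec R 3) u \in unitmx.
Proof.
move=> Uu; apply: gram_unit => //; first exact: smooth_on_differentiable Uu.
  by move=> w; exact: F_inj.
exact: basis_unitmx.
Qed.

Let G1 : gram F v p = 1%:M.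
Proof. by apply/matrixP => a b; rewrite !mxE hv. Qed.

Let M1 a b : M p a b = (a == b)%:R.
Proof. by rewrite /M G1 invmx1 mxE. Qed.

Let Y_trace' u : U u -> \sum_a \sum_b M u a b * beta u b a = c * dot (Y u) (Y u).
Proof.
move=> Uu; have := Y_trace Uu.
rewrite -(mxtrace_congr _ uv (ug Uu)) -gram_congr; last first.
  exact: smooth_on_differentiable Uu.
rewrite -(hess_congr v (Y u) oU Uu sF) => h; rewrite -[RHS]opprK -h.
rewrite /mxtrace -sumrN; apply: eq_bigr => a _; rewrite mxE -sumrN.
apply: eq_bigr => b _; rewrite -mulrN; congr (_ * _).
by rewrite mxE /beta (second_form_Y _ _ Uu) dotC (DFC _ _ Uu).
Qed.

Let dM a b w : derivable (fun u => M u a b) p w.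
Proof.
have [+ _] := @Ck_invgram R 3 4 U F v 1%N a b oU sF uG.
by move=> /(_ p Up)/diff_derivable; exact.
Qed.

(** Derivative of the product of the inverse and the Gram matrix, which is constantly 1, at a point
    where both factors are the identity. *)
Let DM a b w : 'D_w (fun u => M u a b) p =
  - (dot (pd w (pd (v a) F) p) (pd (v b) F p) +
     dot (pd (v a) F p) (pd w (pd (v b) F) p)).
Proof.
pose g d e u := dot (pd (v d) F u) (pd (v e) F u).
have dg d e : derivable (g d e) p w.
  by apply: derivable_dot; apply: smooth_on_derivable Up.
have : 'D_w (\sum_d (fun u => M u a d * g d b u)) p = 0.
  rewrite -(derive_cst ((a == b)%:R : R) p w).
  apply: near_eq_derive; apply: near_open oU Up _ => u Uu.
  have := congr1 (fun A : 'M[R]_3 => A a b) (mulVmx (uG Uu)).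
  rewrite !mxE fct_sumE => <-; apply: eq_bigr => d _.
  by rewrite /M /g [in RHS]mxE.
rewrite derive_sum => [|d]; last exact: derivableM.
under eq_bigr => d _.
  rewrite deriveM// M1 [g d b p]hv [_ *: 'D_w (g d b) p]mulrC.
  rewrite [_ *: 'D_w _ p]mulrC.
  over.
rewrite big_split /= (bigD1 a)//= eqxx mulr1 big1 => [|d da]; last first.
  by rewrite eq_sym (negPf da) mulr0.
rewrite addr0 (bigD1 b)//= eqxx mulr1 big1 => [|d db]; last first.
  by rewrite (negPf db) mulr0.
rewrite addr0 addrC => /eqP; rewrite addr_eq0 => /eqP ->; congr (- _).
exact: (derive_smooth_dot w Up (sDF _) (sDF _)).
Qed.

Lemma trace_at : \sum_a dot (pd (v a) Y p) (pd (v a) F p) = c * dot (Y p) (Y p).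
Proof.
rewrite -Y_trace'//; apply: eq_bigr => a _.
rewrite (bigD1 a)//= big1 => [|b ba]; last by rewrite M1 eq_sym (negPf ba) mul0r.
by rewrite M1 eqxx mul1r addr0.
Qed.

(** Leibniz rule in [Y_trace']; the subtracted double sum is the contribution of [DM]. *)
Lemma dtrace_at w :
  \sum_a (dot (pd (v a) (pd w Y) p) (pd (v a) F p) +
          dot (pd (v a) Y p) (pd (v a) (pd w F) p)) -
  \sum_a \sum_b (dot (pd (v a) (pd w F) p) (pd (v b) F p) +
                 dot (pd (v a) F p) (pd (v b) (pd w F) p)) *
      dot (pd (v a) Y p) (pd (v b) F p) =
  2 * c * dot (Y p) (pd w Y p).
Proof.
have dbeta a b : derivable (fun u => beta u a b) p w.
  by apply: derivable_dot; apply: smooth_on_derivable Up.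
have Dbeta a b : 'D_w (fun u => beta u a b) p =
    dot (pd w (pd (v a) Y) p) (pd (v b) F p) +
    dot (pd (v a) Y p) (pd w (pd (v b) F) p).
  exact: (derive_smooth_dot w Up (sDY _) (sDF _)).
have : 'D_w (\sum_a \sum_b (fun u => M u a b * beta u b a)) p =
    'D_w (fun u => c * dot (Y u) (Y u)) p.
  apply: near_eq_derive; apply: near_open oU Up _ => u Uu.
  rewrite fct_sumE -Y_trace'//; apply: eq_bigr => a _; rewrite fct_sumE.
  by [].
rewrite derive_sum => [|a]; last by apply: derivable_sum => b; exact: derivableM.
have dYY : derivable (fun u => dot (Y u) (Y u)) p w.
  by apply: derivable_dot; apply: smooth_on_derivable Up.
have -> : 'D_w (fun u => c * dot (Y u) (Y u)) p = 2 * c * dot (Y p) (pd w Y p).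
  rewrite deriveMl//; rewrite (derive_smooth_dot w Up sY sY) (dotC (pd w Y p)).
  by ring.
move=> <-.
have -> : \sum_a 'D_w (\sum_b (fun u => M u a b * beta u b a)) p =
  \sum_a \sum_b (M p a b * 'D_w (fun u => beta u b a) p +
                 beta p b a * 'D_w (fun u => M u a b) p).
  apply: eq_bigr => a _; rewrite derive_sum => [|b]; last exact: derivableM.
  by apply: eq_bigr => b _; rewrite deriveM.
rewrite -sumrB; apply: eq_bigr => a _; rewrite big_split /=; congr (_ + _).
  rewrite (bigD1 a)//= big1 => [|b ba]; last by rewrite M1 eq_sym (negPf ba) mul0r.
  by rewrite M1 eqxx mul1r addr0 Dbeta (DYC w _ Up) (DFC w _ Up).
rewrite -sumrN; apply: eq_bigr => b _.
rewrite DM mulrN mulrC (DFC w (v a) Up) (DFC w (v b) Up); congr (- (_ * _)).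
by rewrite /beta (second_form_Y (v b) (v a) Up) (second_form_Y (v a) (v b) Up)
  (DFC (v a) (v b) Up).
Qed.

End frame_at_point.

Lemma local_grad0 p w : U p -> dot (Y p) (pd w Y p) = 0.
Proof.
move=> Up; have [v hv uv] := pd_frame (smooth_on_differentiable sF Up) (fun w => @F_inj p w Up).
have H : forall a, dot (Y p) (pd (v a) Y p) = 0.
  apply: (@pointwise_grad0 R c (Y p) (fun a => pd (v a) F p)
    (fun a => pd (v a) Y p) (fun a b => pd (v a) (pd (v b) F) p)
    (fun a b => pd (v a) (pd (v b) Y) p)) => //.
  - by move=> a; exact: Y_normal.
  - by move=> a b; exact: second_form_Y.
  - by move=> a b; exact: DFC.
  - by move=> a b; exact: DYC.
  - by move=> a b; rewrite Y_isom.
  - by move=> a b d; exact: koszul_Y.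
  - by move=> a b d; exact: codazzi_Y.
  - by move=> a b d e; exact: gauss_Y.
  - exact: trace_at.
  - by move=> d; exact: dtrace_at.
rewrite -[w](mulmxKV uv) mulmx_sum_row.
rewrite pd_lin; last exact: smooth_on_differentiable Up.
by rewrite dot_sumr big1// => a _; rewrite dotZr rowK H mulr0.
Qed.

Lemma local_rigidity p : U p ->
  (forall w, pd w Y p = pd w F p) /\ c * dot (Y p) (Y p) = 3.
Proof.
move=> Up; have [v hv uv] := pd_frame (smooth_on_differentiable sF Up) (fun w => @F_inj p w Up).
have [H1 H2] : (forall a, pd (v a) Y p = pd (v a) F p) /\ c * dot (Y p) (Y p) = 3.
  apply: (@pointwise_rigid R c (Y p) (fun a => pd (v a) F p)
    (fun a => pd (v a) Y p) (fun a b => pd (v a) (pd (v b) F) p)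
    (fun a b => pd (v a) (pd (v b) Y) p)) => //.
  - by move=> a; exact: Y_normal.
  - by move=> a b; exact: second_form_Y.
  - by move=> a b; exact: DFC.
  - by move=> a b; exact: DYC.
  - by move=> a b; rewrite Y_isom.
  - by move=> a b d; exact: koszul_Y.
  - by move=> a b d; exact: codazzi_Y.
  - by move=> a b d e; exact: gauss_Y.
  - exact: trace_at.
  - by move=> d; exact: dtrace_at.
  - move=> a b; have s0 : smooth_on U (fun=> 0 : 'rV[R]_4).
      exact: smooth_on_cst.
    have := @derive_dot_eq R 3 4 U Y (pd (v b) Y) (fun=> 0) (fun=> 0) p (v a)
      oU Up sY (sDY _) s0 s0.
    move=> H; rewrite addrC; apply: etrans (H _) _ => [z Uz|].
      by rewrite local_grad0// dot0l.
    by rewrite dot0l dot0r addr0.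
split=> // w; rewrite -[w](mulmxKV uv) mulmx_sum_row.
rewrite !pd_lin; try exact: smooth_on_differentiable Up.
by apply: eq_bigr => a _; rewrite rowK H1.
Qed.

End local_rigidity.

(** * The Laplacian of the position vector *)

Section local_laplacian.
Variables (R : realType) (n m : nat).
Implicit Types (U : set 'rV[R]_n) (F : 'rV[R]_n -> 'rV[R]_m) (u : 'rV[R]_n).

Local Notation e := (@basis_vec R n).
Local Notation ginv F u := (invmx (gram F e u)).

(* For an induced metric, [Gamma^k_ij = g^kl <d_i d_j F, d_l F>]. *)
Definition sff F u (i j : 'I_n) : 'rV[R]_m :=
  pd (e i) (pd (e j) F) u - \sum_k (\sum_l ginv F u k l *
    dot (pd (e i) (pd (e j) F) u) (pd (e l) F u)) *: pd (e k) F u.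

(** The position vector's Laplacian, with the sign of Delta; the order [j i] is the one produced by
    the trace of a matrix product. *)
Definition lapv F u : 'rV[R]_m := - \sum_i \sum_j ginv F u i j *: sff F u j i.

(** The sum subtracted in [sff] is the orthogonal projection onto the tangent space, computed with
    the inverse Gram matrix. *)
Lemma sff_normal F u i j l : gram F e u \in unitmx ->
  dot (sff F u i j) (pd (e l) F u) = 0.
Proof.
move=> ug; rewrite dotBl dot_suml; apply/eqP; rewrite subr_eq0; apply/eqP.
pose q := \row_l dot (pd (e i) (pd (e j) F) u) (pd (e l) F u).
have -> : dot (pd (e i) (pd (e j) F) u) (pd (e l) F u) =
   ((q *m (ginv F u)^T) *m gram F e u) 0 l.
  rewrite -mulmxA (_ : (ginv F u)^T = ginv F u) ?mulVmx// ?mulmx1 ?mxE//.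
  rewrite trmx_inv; congr invmx; apply/matrixP => a b; rewrite !mxE; exact: dotC.
rewrite [LHS]mxE; apply: eq_bigr => k _; rewrite dotZl.
rewrite [gram _ _ _ _ _]mxE [(q *m _) _ _]mxE.
by congr (_ * _); apply: eq_bigr => l' _; rewrite !mxE mulrC.
Qed.

Lemma lapv_normal F u l : gram F e u \in unitmx ->
  dot (lapv F u) (pd (e l) F u) = 0.
Proof.
move=> ug; rewrite dotNl dot_suml big1 ?oppr0// => i _.
by rewrite dot_suml big1// => j _; rewrite dotZl sff_normal ?mulr0.
Qed.

Lemma lapv_dot F u N : (forall l, dot (pd (e l) F u) N = 0) ->
  dot (lapv F u) N = - \tr (ginv F u *m hess F e N u).
Proof.
move=> NF; rewrite dotNl dot_suml; congr (- _); apply: eq_bigr => i _.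
rewrite dot_suml mxE; apply: eq_bigr => j _; rewrite dotZl [in RHS]mxE.
rewrite dotBl dot_suml [X in _ - X]big1 ?subr0// => k _.
by rewrite dotZl NF mulr0.
Qed.

Lemma smooth_lapv U F : open U -> smooth_on U F ->
  (forall u, U u -> gram F e u \in unitmx) -> smooth_on U (lapv F).
Proof.
move=> oU sF ug; apply/smooth_on_coord => // a k.
have sDF v : smooth_on U (pd v F) by exact: smooth_pd.
have sDDF v w : smooth_on U (pd v (pd w F)) by exact: smooth_pd.
have Cc (G : 'rV[R]_n -> 'rV[R]_m) : smooth_on U G -> Ck k U (fun u => G u 0 a).
  by move/(smooth_on_coord _ oU); exact.
have -> : (fun u => lapv F u 0 a) = (fun u => - \sum_i \sum_j ginv F u i j *
   (pd (e j) (pd (e i) F) u 0 a - \sum_k (\sum_l ginv F u k l *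
    dot (pd (e j) (pd (e i) F) u) (pd (e l) F u)) * pd (e k) F u 0 a)).
  apply/funext => u; rewrite mxE summxE; congr (- _); apply: eq_bigr => i _.
  rewrite summxE; apply: eq_bigr => j _; rewrite mxE; congr (_ * _).
  rewrite mxE; congr (_ + _); rewrite mxE summxE; congr (- _).
  by apply: eq_bigr => l _; rewrite mxE.
apply: CkN => //; apply: Ck_sum => // i; apply: Ck_sum => // j.
apply: CkM => //; first exact: Ck_invgram.
apply: CkD => //; first exact: Cc.
apply: CkN => //; apply: Ck_sum => // l; apply: CkM => //; last exact: Cc.
apply: Ck_sum => // l'; apply: CkM => //; first exact: Ck_invgram.
exact: Ck_dot.
Qed.

End local_laplacian.

(** * Invariance under a change of chart *)

Section reparametrisation.
Variables (R : realType) (n m : nat).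
Variables (W V : set 'rV[R]_n) (F G : 'rV[R]_n -> 'rV[R]_m).
Variable (t : 'rV[R]_n -> 'rV[R]_n) (u : 'rV[R]_n).
Hypotheses (oW : open W) (oV : open V) (Wu : W u).
Hypothesis WV : forall z, W z -> V (t z).
Hypotheses (st : smooth_on W t) (sF : smooth_on V F) (sG : smooth_on W G).
Hypothesis GF : forall z, W z -> G z = F (t z).

Local Notation e := (@basis_vec R n).

Let Vtu : V (t u). Proof. exact: WV. Qed.

Lemma pd_reparam w : pd w G u = pd (pd w t u) F (t u).
Proof.
have dt := smooth_on_differentiable st Wu.
have dF := smooth_on_differentiable sF Vtu.
by rewrite (eq_pd w oW Wu GF) !pdE; exact: derive_comp dt dF.
Qed.

(** The extra term of the second-order chain rule is a first derivative of [F], hence tangential and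
    orthogonal to [N]. *)
Lemma pd2_reparam_dot N v w : (forall z, dot (pd z F (t u)) N = 0) ->
  dot (pd v (pd w G) u) N = dot (pd (pd v t u) (pd (pd w t u) F) (t u)) N.
Proof.
move=> NF; rewrite !pdE.
apply: etrans (esym (derive2_dot_cst N v w oW Wu sG)) _.
apply: etrans _ (derive2_dot_cst N ('D_v t u) ('D_w t u) oV Vtu sF).
pose f z := dot (F z) N.
have E : 'D_v ('D_w (fun z => dot (G z) N)) u = 'D_v ('D_w (f \o t)) u.
  apply: near_eq_derive; apply: near_open oW Wu _ => z Wz.
  by apply: near_eq_derive; apply: near_open oW Wz _ => y Wy; rewrite GF.
have Cf : Ck 2 V f by exact: smooth_on_dot_cst.
have D0 : 'D_('D_v ('D_w t) u) f (t u) = 0.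
  have dF : derivable F (t u) ('D_v ('D_w t) u) by exact: smooth_on_derivable sF Vtu.
  apply: etrans (derive_dot_cst N dF) _.
  by have := NF ('D_v ('D_w t) u); rewrite pdE.
apply: etrans E _; apply: etrans (derive2_comp v w oW oV WV Wu st Cf) _.
by rewrite D0 addr0.
Qed.

Hypothesis uG : gram G e u \in unitmx.
Hypothesis uF : gram F e (t u) \in unitmx.

(* The difference of the two Laplacians is normal, and the normal part of the
   second derivatives is tensorial. *)
Lemma lapv_reparam : lapv G u = lapv F (t u).
Proof.
pose J : 'M[R]_n := \matrix_a pd (e a) t u.
have dF := smooth_on_differentiable sF Vtu.
have gE : gram G e u = J *m gram F e (t u) *m J^T.
  by rewrite -gram_congr//; apply/matrixP => a b; rewrite !mxE !pd_reparam.
have uJ : J \in unitmx by move: uG; rewrite gE !unitmx_mul => /andP[/andP[]].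
have normal_of N : (forall l, dot (pd (e l) F (t u)) N = 0) ->
    forall z, dot (pd z F (t u)) N = 0.
  move=> NF z; rewrite {1}(row_sum_delta z) pd_lin// dot_suml big1// => l _.
  by rewrite dotZl NF mulr0.
have GN l : dot (lapv G u) (pd (e l) F (t u)) = 0.
  rewrite -[e l](mulmxKV uJ) mulmx_sum_row pd_lin// dot_sumr big1// => a _.
  by rewrite dotZr rowK -pd_reparam lapv_normal ?mulr0.
pose d := lapv G u - lapv F (t u).
have dN l : dot (pd (e l) F (t u)) d = 0.
  by rewrite dotC dotBl GN lapv_normal// subr0.
have dN' z : dot (pd z F (t u)) d = 0 by exact: normal_of.
have hE : hess G e d u = J *m hess F e d (t u) *m J^T.
  rewrite -(hess_congr _ d oV Vtu sF).
  by apply/matrixP => a b; rewrite !mxE pd2_reparam_dot.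
(* Since [d] is a difference of the two sides, its square splits into their products with [d]; these
   are traces related by the congruence with [J]. *)
apply/eqP; rewrite -subr_eq0 -dot_eq0 -/d {1}/d dotBl subr_eq0; apply/eqP.
rewrite !lapv_dot//; first by rewrite gE hE mxtrace_congr.
by move=> l; rewrite pd_reparam dN'.
Qed.

End reparametrisation.

(** * The Laplace map in charts *)

Section charts.
Variables (R : realType) (n : nat) (M : smooth_manifold R n).
Implicit Types (phi psi : chart R n M).

Local Notation img phi := (cmap phi @` cdom phi).

Lemma cinv_dom phi u : img phi u -> cdom phi (cinv phi u).
Proof. by move=> [p Dp <-]; rewrite cmapK. Qed.

Lemma cinvK phi u : img phi u -> cmap phi (cinv phi u) = u.
Proof. by move=> [p Dp <-]; rewrite cmapK. Qed.

Lemma cmap_img phi p : cdom phi p -> img phi (cmap phi p).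
Proof. by move=> Dp; exists p. Qed.

(** Inside the open image of [phi] this set is the preimage of [cdom psi] under [cinv phi]. *)
Lemma open_transition_dom phi psi : open (cmap phi @` (cdom phi `&` cdom psi)).
Proof.
rewrite openE => _ [p [Dp Dp'] <-].
have cc : {for cmap phi p, continuous (cinv phi)}.
  have := @cinv_continuous _ _ _ phi; rewrite continuous_open_subspace; last first.
    exact: cimg_open.
  by apply; rewrite inE; exact: cmap_img.
have N1 : nbhs (cmap phi p) (img phi).
  by apply: open_nbhs_nbhs; split; [exact: cimg_open|exact: cmap_img].
have N2 : nbhs (cmap phi p) (cinv phi @^-1` cdom psi).
  apply: cc; apply: open_nbhs_nbhs; split; first exact: cdom_open.
  by rewrite cmapK.
apply: filterS (filterI N1 N2) => u [Iu Du].
by exists (cinv phi u); [split => //; exact: cinv_dom|exact: cinvK].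
Qed.

Lemma nbhs_cmap phi p (B : set 'rV[R]_n) : cdom phi p -> nbhs (cmap phi p) B ->
  nbhs p (cdom phi `&` cmap phi @^-1` B).
Proof.
move=> Dp NB; apply: filterI.
  by apply: open_nbhs_nbhs; split; [exact: cdom_open|].
have := @cmap_continuous _ _ _ phi; rewrite continuous_open_subspace; last first.
  exact: cdom_open.
by move=> /(_ p); apply => //; rewrite inE.
Qed.

Lemma mdiff_pd m (f : M -> 'rV[R]_m) phi u v : img phi u ->
  differentiable (f \o cinv phi) u ->
  mdiff f phi (cinv phi u) v = pd v (f \o cinv phi) u.
Proof. by move=> Iu df; rewrite /mdiff cinvK// pdE deriveE. Qed.

Section immersed.
Variables (m : nat) (x : M -> 'rV[R]_m).
Hypothesis hx : immersion x.

Local Notation F phi := (x \o cinv phi).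
Local Notation e := (@basis_vec R n).

Lemma smooth_chart phi : atlas phi -> smooth_on (img phi) (F phi).
Proof. by have [sx _] := hx; exact: sx. Qed.

Lemma mdiff_chart phi u v : atlas phi -> img phi u ->
  mdiff x phi (cinv phi u) v = pd v (F phi) u.
Proof.
move=> Aphi Iu; apply: mdiff_pd => //.
exact: smooth_on_differentiable (smooth_chart Aphi) Iu.
Qed.

Lemma pd_chart_inj phi u w : atlas phi -> img phi u -> pd w (F phi) u = 0 -> w = 0.
Proof.
move=> Aphi Iu; rewrite -mdiff_chart// => w0.
have [_ /(_ phi (cinv phi u) Aphi (cinv_dom Iu))] := hx; apply.
by rewrite w0 /mdiff linear0.
Qed.

Lemma gram_chart_unit phi u : atlas phi -> img phi u ->
  gram (F phi) e u \in unitmx.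
Proof.
move=> Aphi Iu; apply: gram_unit.
- exact: smooth_on_differentiable (smooth_chart Aphi) Iu.
- by move=> w; exact: pd_chart_inj.
- exact: basis_unitmx.
Qed.

Lemma metric_chart phi u : atlas phi -> img phi u ->
  metric_mx x phi u = gram (F phi) e u.
Proof.
move=> Aphi Iu; apply/matrixP => i j; rewrite !mxE /induced_metric.
by rewrite !mdiff_chart.
Qed.

Lemma partial_metric phi u i j l : atlas phi -> img phi u ->
  partial i (fun u' => metric_mx x phi u' j l) u =
  dot (pd (e i) (pd (e j) (F phi)) u) (pd (e l) (F phi) u) +
  dot (pd (e j) (F phi) u) (pd (e i) (pd (e l) (F phi)) u).
Proof.
move=> Aphi Iu; have sDF v := smooth_pd v (smooth_chart Aphi).
apply: etrans (derive_smooth_dot (e i) Iu (sDF (e j)) (sDF (e l))).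
apply: near_eq_derive; apply: near_open (@cimg_open _ _ _ phi) Iu _ => z Iz.
by rewrite metric_chart// mxE.
Qed.

(** Of the six terms of the metric derivatives four cancel by symmetry of second derivatives; the
    other two are equal and absorb the factor 1/2. *)
Lemma christoffel_chart phi u k i j : atlas phi -> img phi u ->
  christoffel x phi k i j u = \sum_l invmx (gram (F phi) e u) k l *
    dot (pd (e i) (pd (e j) (F phi)) u) (pd (e l) (F phi) u).
Proof.
move=> Aphi Iu; have sF := smooth_chart Aphi.
have C := pdC _ _ (@cimg_open _ _ _ phi) Iu sF.
rewrite /christoffel mulr_sumr; apply: eq_bigr => l _.
rewrite !partial_metric// metric_chart// mulrCA; congr (_ * _).
rewrite (C (e j) (e i)) (C (e l) (e i)) (C (e l) (e j)).
rewrite (dotC (pd (e i) (F phi) u)) (dotC (pd (e j) (F phi) u)).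
set a := dot _ _; set b := dot _ _; set d := dot _ _.
by field.
Qed.

Lemma laplace_map_chart_at p : laplace_map x p =
  lapv (F (chart_at p)) (cmap (chart_at p) p).
Proof.
have Aphi := chart_at_atlas p; have Dp := chart_at_dom p.
rewrite /laplace_map /laplacian; move: (chart_at p) Aphi Dp => phi Aphi Dp.
have Iu := cmap_img Dp; move: (cmap phi p) Iu => u Iu.
have sF := smooth_chart Aphi.
have sDF v := smooth_pd v sF.
have pE k z a : img phi z -> partial k ((fun q => x q 0 a) \o cinv phi) z =
    pd (e k) (F phi) z 0 a.
  move=> Iz; rewrite pdE; apply: etrans (esym (derive_coord _ _)) _ => //.
  exact: smooth_on_derivable sF Iz.
apply/rowP => a; rewrite !mxE summxE; congr (- _); apply: eq_bigr => i _.
rewrite mxE summxE; apply: eq_bigr => j _; rewrite metric_chart//.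
rewrite [in LHS]mxE [in RHS]mxE; congr (_ * _); rewrite [in RHS]mxE; congr (_ + _).
  have -> : pd (e j) (pd (e i) (F phi)) u 0 a =
      'D_(e j) (fun z => pd (e i) (F phi) z 0 a) u.
    rewrite pdE derive_coord//.
    exact: smooth_on_derivable (sDF _) Iu.
  apply: near_eq_derive; apply: near_open (@cimg_open _ _ _ phi) Iu _ => z Iz.
  exact: pE.
rewrite [in RHS]mxE summxE; congr (- _); apply: eq_bigr => k _.
by rewrite [in RHS]mxE christoffel_chart// pE.
Qed.

(** The chart used by [laplacian] changes with the point. Independence of the chart is what permits
    differentiating the Laplace map within one fixed chart. *)
Lemma laplace_map_chart phi p : atlas phi -> cdom phi p ->
  laplace_map x p = lapv (F phi) (cmap phi p).
Proof.
move=> Aphi Dp; rewrite laplace_map_chart_at.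
have Apsi := chart_at_atlas p; have Dp' := chart_at_dom p.
move: (chart_at p) Apsi Dp' => psi Apsi Dp'.
pose W := cmap psi @` (cdom psi `&` cdom phi).
have Wp : W (cmap psi p) by exists p.
have WI z : W z -> img psi z by move=> [q [Dq _] <-]; exact: cmap_img.
have E : cmap phi p = (cmap phi \o cinv psi) (cmap psi p) by rewrite /= cmapK.
rewrite E; apply: (@lapv_reparam _ _ _ W (img phi)) => //.
- exact: open_transition_dom.
- exact: cimg_open.
- by move=> _ [q [Dq Dq'] <-] /=; rewrite cmapK//; exact: cmap_img.
- exact: atlas_smooth.
- exact: smooth_chart.
- exact: smooth_on_sub (smooth_chart Apsi).
- by move=> _ [q [Dq Dq'] <-] /=; rewrite !cmapK.
- by apply: gram_chart_unit => //; exact: WI.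
- by rewrite -E; apply: gram_chart_unit => //; exact: cmap_img.
Qed.

Lemma smooth_laplace phi : atlas phi -> smooth_on (img phi) (laplace_map x \o cinv phi).
Proof.
move=> Aphi; have oI := @cimg_open _ _ _ phi.
have /(smooth_on_coord _ oI) sL := smooth_lapv oI (smooth_chart Aphi)
  (fun u Iu => gram_chart_unit Aphi Iu).
apply/(smooth_on_coord _ oI) => i k; apply: Ck_ext oI _ (sL i k) => u Iu /=.
by rewrite (laplace_map_chart Aphi (cinv_dom Iu)) cinvK.
Qed.

End immersed.
End charts.

(** * Hyperspheres *)

Section translation.
Variables (R : realType) (n m : nat) (U : set 'rV[R]_n).
Variables (F : 'rV[R]_n -> 'rV[R]_m) (a : 'rV[R]_m).

Lemma smooth_on_subc : open U -> smooth_on U F -> smooth_on U (fun u => F u - a).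
Proof.
move=> oU sF; apply/smooth_on_coord => // i j.
have -> : (fun u => (F u - a) 0 i) = (fun u => F u 0 i + (- a) 0 i).
  by apply/funext => u; rewrite mxE.
by apply: CkD => //; [move: sF => /(smooth_on_coord _ oU); exact|exact: Ck_cst].
Qed.

Lemma pd_subc w u : smooth_on U F -> U u -> pd w (fun u => F u - a) u = pd w F u.
Proof.
move=> sF Uu; rewrite !pdE.
apply: etrans (deriveB (smooth_on_derivable sF Uu) (derivable_cst a u w)) _.
by rewrite derive_cst subr0.
Qed.

End translation.

Lemma smooth_on_id (R : realType) n (U : set 'rV[R]_n) : open U -> smooth_on U id.
Proof.
move=> oU [|k] /=; first by move=> u _; exact: cvg_id.
split=> [u _|v]; first by have [] := is_diff_id (u : 'rV[R]_n).
have s := smooth_on_cst v oU.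
have -> : (fun u => 'D_v id u) = fun=> v by apply/funext => u; exact: derive_id.
exact: s.
Qed.

Section sphere.
Variables (R : realType) (k : nat) (U : set 'rV[R]_k) (F : 'rV[R]_k -> 'rV[R]_k.+1).
Variables (a : 'rV[R]_k.+1) (r : R).
Hypothesis oU : open U.
Hypothesis sF : smooth_on U F.
Hypothesis F_inj : forall u w, U u -> pd w F u = 0 -> w = 0.
Hypothesis r_gt0 : 0 < r.
Hypothesis F_sphere : forall u, U u -> hypersphere a r (F u).

Let FaE u : U u -> dot (F u - a) (F u - a) = r ^+ 2.
Proof. exact: F_sphere. Qed.

Let sFa := smooth_on_subc a oU sF.

Lemma sphere_normal u w : U u -> dot (F u - a) (pd w F u) = 0.
Proof.
move=> Uu.
(* A constant vector of length [r], so that the sphere equation becomes an equality of two inner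
   products. *)
have s1 : smooth_on U (fun=> r *: delta_mx 0 0 : 'rV[R]_k.+1) by exact: smooth_on_cst.
have := derive_dot_eq w oU Uu sFa sFa s1 s1.
rewrite (pd_subc a w sF Uu) pd_cst dot0l dot0r addr0 (dotC (pd w F u)) => H.
have : dot (F u - a) (pd w F u) + dot (F u - a) (pd w F u) = 0.
  apply: H => z Uz; rewrite FaE// dotZl dotZr dot_delta mxE !eqxx mulr1; ring.
lra.
Qed.

Lemma sphere_second u v w : U u ->
  dot (pd v (pd w F) u) (F u - a) = - dot (pd v F u) (pd w F u).
Proof.
move=> Uu; have s0 : smooth_on U (fun=> 0 : 'rV[R]_k.+1) by exact: smooth_on_cst.
have := derive_dot_eq v oU Uu sFa (smooth_pd w sF) s0 s0.
rewrite (pd_subc a v sF Uu) pd_cst dot0l addr0 => H.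
have /eqP : dot (pd v F u) (pd w F u) + dot (F u - a) (pd v (pd w F) u) = 0.
  by apply: H => z Uz; rewrite sphere_normal// dot0l.
by rewrite addrC addr_eq0 dotC => /eqP.
Qed.

Let Fa_neq0 u : U u -> F u - a != 0.
Proof. by move=> Uu; rewrite -dot_gt0 FaE// exprn_gt0. Qed.

(** [lapv F u] is normal, hence a multiple of [F u - a]. In that direction the second fundamental
    form is minus the metric, whose trace is the dimension [k]. *)
Lemma lapv_sphere u : U u -> lapv F u = (k%:R / r ^+ 2) *: (F u - a).
Proof.
move=> Uu; have dF := smooth_on_differentiable sF Uu.
have ug : gram F (@basis_vec R k) u \in unitmx.
  by apply: gram_unit => //; [move=> w; exact: F_inj|exact: basis_unitmx].
have LN w : dot (lapv F u) (pd w F u) = 0.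
  rewrite {1}(row_sum_delta w) pd_lin// dot_sumr big1// => l _.
  by rewrite dotZr lapv_normal// mulr0.
rewrite (normal_line dF (fun w => @F_inj u w Uu) (Fa_neq0 Uu) _ LN); last first.
  by move=> w; exact: sphere_normal.
rewrite FaE// lapv_dot; last by move=> l; rewrite dotC sphere_normal.
congr (_ / _ *: _).
have -> : hess F (@basis_vec R k) (F u - a) u = - gram F (@basis_vec R k) u.
  by apply/matrixP => i j; rewrite !mxE sphere_second.
by rewrite mulmxN mulVmx// -(scaleN1r 1%:M) mxtraceZ mxtrace1 mulN1r opprK.
Qed.

End sphere.

(** * Openness of the image in the sphere *)

Section local_injectivity.
Variables (R : realType) (n m : nat).

(** Composed with a linear left inverse of its differential, [F] has the identity as differential at
    [u]. On a fibre the remainder is then [- h], and the bound [2^-1] times the norm of [h] forces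
    [h = 0]. *)
Lemma near_neq (F : 'rV[R]_n -> 'rV[R]_m) u : differentiable F u ->
  (forall w, 'd F u w = 0 -> w = 0) ->
  \forall h \near (0 : 'rV[R]_n), F (h + u) = F u -> h = 0.
Proof.
move=> dF F0; have [P PL] := linear_left_inverse F0.
pose G z := F z *m P.
have GE j : (fun z => G z 0 j) = \sum_i (fun z => P i j *: F z 0 i).
  by apply/funext => z; rewrite mxE fct_sumE; apply: eq_bigr => i _; exact: mulrC.
have dFi i : differentiable (fun z => F z 0 i) u.
  by have /differentiable_row := dF; exact.
have dG : differentiable G u.
  apply/differentiable_row => j; rewrite GE.
  by apply: differentiable_sum => i; exact: differentiableZ.
have GL h : 'd G u h = h.
  rewrite -[RHS]PL -!deriveE//; apply/rowP => j.
  have -> : 'D_h G u 0 j = 'D_h (fun z => G z 0 j) u.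
    by apply: derive_coord; exact: diff_derivable.
  rewrite GE derive_sum => [|i]; last first.
    by apply: derivableZ; exact: diff_derivable.
  rewrite mxE; apply: eq_bigr => i _.
  rewrite deriveZ; last exact: diff_derivable.
  have -> : 'D_h F u 0 i = 'D_h (fun z => F z 0 i) u.
    by apply: derive_coord; exact: diff_derivable.
  exact: mulrC.
have /diff_locally/eqaddoP/(_ (2^-1)) := dG.
rewrite invr_gt0 ltr0n => /(_ isT); apply: filterS => h /= + Fh.
rewrite !fctE GL /G Fh opprD addrA subrr add0r normrN => hh.
by apply/eqP; rewrite -normr_le0; lra.
Qed.

End local_injectivity.

Lemma near_translate (R : realType) n (U : set 'rV[R]_n) u : open U -> U u ->
  \forall h \near (0 : 'rV[R]_n), U (h + u).
Proof.
move=> oU Uu; have : \near u, U u by exact: open_nbhs_nbhs.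
by rewrite (near_shift 0) subr0.
Qed.

Lemma min_critical (R : realType) n (f : 'rV[R]_n -> R) (u z : 'rV[R]_n) (e : R) w :
  ball u e z -> (forall t, ball u e t -> differentiable f t) ->
  (forall t, ball u e t -> f z <= f t) -> 'D_w f z = 0.
Proof.
(* Up to parameter [s0] the segment from [z] along [w] stays in the ball; the added 1 covers
   [w = 0]. *)
move=> uz df fz; pose s0 := (e - `|z - u|) / (`|w| + 1).
have w1 : 0 < `|w| + 1 by rewrite ltr_wpDl.
have s00 : 0 < s0.
  by rewrite divr_gt0// subr_gt0 distrC; move: uz; rewrite -ball_normE.
have inb (s : R) : s \in `]- s0, s0[%R -> ball u e (s *: w + z).
  rewrite in_itv /= => s0s; rewrite -ball_normE /= /ball_ /= distrC -addrA.
  rewrite (le_lt_trans (ler_normD _ _))// -ltrBrDr normrZ.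
  have : `|s| < s0 by rewrite ltr_norml.
  rewrite /s0 ltr_pdivlMr//; apply: le_lt_trans.
  by rewrite ler_wpM2l// lerDl.
have mem0 : 0 \in `]- s0, s0[%R by rewrite in_itv /= oppr_lt0 s00.
have dl (s : R) : s \in `]- s0, s0[%R ->
    is_derive s 1 (fun t : R => f (t *: w + z)) ('D_w f (s *: w + z)).
  by move=> /inb si; apply: is_derive_line; exact/diff_derivable/df.
have D0 : is_derive (0 : R) 1 (fun t : R => f (t *: w + z)) 0.
  apply: (@derive1_at_min R (fun t : R => f (t *: w + z)) (- s0) s0 0) => //.
  - by rewrite (le_trans (_ : _ <= 0)) ?oppr_le0 ?ltW.
  - by move=> t /dl [].
  - by move=> t /inb ti; rewrite scale0r add0r; exact: fz.
have [_ <-] := D0; have [_ ->] := dl _ mem0.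
by rewrite scale0r add0r.
Qed.

Section sphere_image.
Variables (R : realType) (k : nat) (U : set 'rV[R]_k) (F : 'rV[R]_k -> 'rV[R]_k.+1).
Variables (a : 'rV[R]_k.+1) (r : R).
Hypothesis oU : open U.
Hypothesis sF : smooth_on U F.
Hypothesis F_inj : forall u w, U u -> pd w F u = 0 -> w = 0.
Hypothesis r_gt0 : 0 < r.
Hypothesis F_sphere : forall u, U u -> hypersphere a r (F u).

Let sq b z := dot (F z - b) (F z - b).

Let d_sq b z : U z -> differentiable (sq b) z.
Proof.
move=> Uz; have sFb := smooth_on_subc b oU sF.
by have [dsq _] := Ck_dot 1 oU sFb sFb; exact: dsq.
Qed.

Let D_sq b z w : U z -> 'D_w (sq b) z = 2 * dot (F z - b) (pd w F z).
Proof.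
move=> Uz; have sFb := smooth_on_subc b oU sF.
apply: etrans (derive_smooth_dot w Uz sFb sFb) _.
rewrite !(pd_subc b w sF Uz) (dotC (pd w F z)); ring.
Qed.

Let isolated u : U u -> exists2 e : R, 0 < e &
  forall z, `|u - z| <= e -> U z /\ (F z = F u -> z = u).
Proof.
move=> Uu; have dF := smooth_on_differentiable sF Uu.
have dF0 w : 'd F u w = 0 -> w = 0.
  by move=> h; apply: (F_inj Uu); rewrite pdE deriveE.
have /nbhs_ballP[e /= e0 eP] : nbhs (0 : 'rV[R]_k)
    [set h | U (h + u) /\ (F (h + u) = F u -> h = 0)].
  exact: filterI (near_translate oU Uu) (near_neq dF dF0).
(* Halved, so that the closed ball of the conclusion lies in the open ball just found. *)
exists (e / 2) => [|z zu]; first by rewrite divr_gt0.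
have /eP[/=] : ball 0 e (z - u).
  rewrite -ball_normE /ball_ /= sub0r opprB (le_lt_trans zu)//.
  by rewrite ltr_pdivrMr// ltr_pMr// ltr1n.
by rewrite subrK => Uz H; split=> // /H/eqP; rewrite subr_eq0 => /eqP.
Qed.

(* Instead of the inverse function theorem: for [y] on the sphere near [F u], a
   minimizer [z] of [|F - y|^2] over a small ball is interior, so [y - a] is
   normal at [z], that is, [y - a = +- (F z - a)]. *)
Lemma sphere_image u : U u -> exists2 d : R, 0 < d & forall y,
  hypersphere a r y -> dot (F u - y) (F u - y) < d -> exists2 z, U z & F z = y.
Proof.
move=> Uu; have [e e0 eP] := isolated Uu.
pose K := closed_ball u e.
have KE z : K z = (`|u - z| <= e) by rewrite /K closed_ballE.
have cK : compact K.
  apply: bounded_closed_compact; last exact: closed_ball_closed.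
  exists (`|u| + e); split; first exact: num_real.
  move=> x ux z; rewrite KE => uz; apply: le_trans (ltW ux).
  by rewrite -[z](subrK u) addrC (le_trans (ler_normD _ _))// lerD2l distrC.
have UK z : K z -> U z by rewrite KE => /eP[].
have contK b (A : set 'rV[R]_k) : A `<=` K -> {within A, continuous (sq b)}.
  move=> AK; apply: continuous_in_subspaceT => z; rewrite inE => /AK/UK Uz.
  exact/differentiable_continuous/d_sq.
have ballK t : ball u e t -> K t by rewrite KE -ball_normE => /ltW.
pose B := K `&` ~` ball u e.
have BK : B `<=` K by move=> z [].
have cB : compact B.
  apply: (subclosed_compact _ cK BK).
  by apply: closedI; [exact: closed_ball_closed|exact/open_closedC/ball_open].
have [m m0 mP] : exists2 m, 0 < m & forall z, B z -> m <= sq (F u) z.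
  (* In dimension 0 the boundary [B] is empty, and any positive bound serves. *)
  have [B0|nB0] := pselect (B !=set0); last first.
    by exists 1 => // z Bz; exfalso; apply: nB0; exists z.
  have [z zB zP] := EVT_min_rV B0 cB (contK (F u) B BK).
  exists (sq (F u) z); last by move=> t Bt; apply: zP; rewrite inE.
  rewrite inE in zB; rewrite dot_gt0 subr_eq0; apply/eqP => Fzu.
  have [Kz nb] := zB; move: Kz; rewrite KE => /eP[_ /(_ Fzu) zu].
  by apply: nb; rewrite zu; exact: ballxx.
(* The bound [m / 4] keeps the minimizer off [B]; [r ^+ 2] excludes the antipodal solution, at
   squared distance 4 r^2. *)
pose d := Num.min (m / 4) (r ^+ 2).
have d0 : 0 < d by rewrite lt_min divr_gt0//= exprn_gt0.
have dm : d <= m / 4 by rewrite ge_min lexx.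
have dr : d <= r ^+ 2 by rewrite ge_min lexx orbT.
exists d => // y Sy yd.
have Ku : K u by rewrite KE subrr normr0 ltW.
have [z zK zP] := EVT_min_rV (ex_intro _ u Ku) cK (contK y K (@subset_refl _ K)).
rewrite inE in zK.
have zu : sq y z < d by apply: le_lt_trans yd; apply: zP; rewrite inE.
have Uz := UK _ zK.
have bz : ball u e z.
  apply: contrapT => nb.
  have := mP z (conj zK nb); apply/negP; rewrite -ltNge.
  have : sq (F u) z <= 2 * sq y z + 2 * dot (F u - y) (F u - y).
    rewrite -subr_ge0 /sq.
    have -> : 2 * dot (F z - y) (F z - y) + 2 * dot (F u - y) (F u - y) -
        dot (F z - F u) (F z - F u) =
        dot ((F z - y) + (F u - y)) ((F z - y) + (F u - y)).
      by rewrite !(dotBl, dotBr, dotDl, dotDr) !(dotC (F u)) !(dotC y); ring.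
    exact: dot_ge0.
  lra.
have crit w : dot (F z - y) (pd w F z) = 0.
  have : 'D_w (sq y) z = 0.
    apply: (min_critical _ bz) => t /ballK Kt; first exact/d_sq/UK.
    by apply: zP; rewrite inE.
  by rewrite D_sq// => /eqP; rewrite mulf_eq0 pnatr_eq0 => /eqP.
have FaE : dot (F z - a) (F z - a) = r ^+ 2 by exact: F_sphere.
have Fa0 : F z - a != 0 by rewrite -dot_gt0 FaE exprn_gt0.
have normal w := sphere_normal oU sF F_sphere w Uz.
have ya w : dot (y - a) (pd w F z) = 0.
  have -> : y - a = (F z - a) - (F z - y) by rewrite opprB [RHS]addrC addrA subrK.
  by rewrite dotBl normal crit subr0.
have dF := smooth_on_differentiable sF Uz.
have := normal_line dF (fun w => @F_inj z w Uz) Fa0 normal ya.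
set s := _ / _ => ys.
exists z => //.
have s2 : s ^+ 2 = 1.
  apply: (mulIf (lt0r_neq0 (exprn_gt0 2 r_gt0))); rewrite mul1r -[RHS]Sy ys.
  by rewrite dotZl dotZr FaE; ring.
move/eqP: s2; rewrite sqrf_eq1 => /orP[|] /eqP s1.
  by apply/(addIr (- a)); rewrite ys s1 scale1r.
exfalso; move: zu; rewrite /sq.
have -> : F z - y = 2 *: (F z - a).
  have -> : F z - y = (F z - a) - (y - a) by rewrite opprB addrA subrK.
  by rewrite ys s1 scaleN1r opprK scaler_nat mulr2n.
rewrite dotZl dotZr FaE => h.
have := lt_le_trans h dr; have := exprn_gt0 2 r_gt0; lra.
Qed.

End sphere_image.

(** * Homothetic Laplace transformations *)

(** The fibre of [D] through [p] is nonempty, open and closed. *)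
Lemma locally_constant_connected (T : topologicalType) (S : Type) (D : T -> S) :
  connected [set: T] -> (forall p, \forall q \near p, D q = D p) ->
  forall p q, D q = D p.
Proof.
move=> cT locD p; pose B := [set q | D q = D p].
suff BT : B = setT by move=> q; have : setT q by []; rewrite -BT.
have oB : open B.
  by rewrite openE => q Bq; apply: filterS (locD q) => z; rewrite /B /= => ->.
have cB : closed B.
  rewrite -(setCK B) closedC openE => q nBq.
  by apply: filterS (locD q) => z zq Bz; apply: nBq; rewrite /B /= -zq.
apply: cT; first by exists p.
- by exists B; rewrite ?setTI.
- by exists B; rewrite ?setTI.
Qed.

Section forward.
Variables (R : realType) (M : smooth_manifold R 3) (x : M -> 'rV[R]_4) (c : R).
Hypothesis hM : connected [set: M].
Hypothesis hx : immersion x.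
Hypothesis c_gt0 : 0 < c.
Hypothesis hc : forall phi p (v w : 'rV[R]_3), atlas phi -> cdom phi p ->
  dot (mdiff (laplace_map x) phi p v) (mdiff (laplace_map x) phi p w) =
  c ^+ 2 * induced_metric x phi p v w.

Local Notation img phi := (cmap phi @` cdom phi).
Let cn0 : c != 0. Proof. exact: lt0r_neq0. Qed.

Let y p := c^-1 *: laplace_map x p.

Let smooth_y phi : atlas phi -> smooth_on (img phi) (y \o cinv phi).
Proof.
move=> Aphi; have oI := @cimg_open _ _ _ phi.
apply/(smooth_on_coord _ oI) => i k.
have /(smooth_on_coord _ oI)/(_ i k) := smooth_laplace hx Aphi.
move=> /(CkM oI (Ck_cst _ _ c^-1)); apply: Ck_ext => // u Iu.
by rewrite [RHS]mxE.
Qed.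

Lemma homothetic_local phi u : atlas phi -> img phi u ->
  (forall w, pd w (y \o cinv phi) u = pd w (x \o cinv phi) u) /\
  c * dot (y (cinv phi u)) (y (cinv phi u)) = 3.
Proof.
move=> Aphi Iu; have oI := @cimg_open _ _ _ phi.
have sF := smooth_chart hx Aphi.
have ug z : img phi z -> gram (x \o cinv phi) (@basis_vec R 3) z \in unitmx.
  exact: gram_chart_unit.
have LE z : img phi z -> y (cinv phi z) = c^-1 *: lapv (x \o cinv phi) z.
  by move=> Iz; rewrite /y (laplace_map_chart hx Aphi (cinv_dom Iz)) cinvK.
have Ln z l : img phi z ->
    dot (y (cinv phi z)) (pd (@basis_vec R 3 l) (x \o cinv phi) z) = 0.
  by move=> Iz; rewrite LE// dotZl lapv_normal ?mulr0//; exact: ug.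
apply: (@local_rigidity R (img phi) (x \o cinv phi) (y \o cinv phi) c) => //.
- exact: smooth_y.
- by move=> z w Iz; exact: pd_chart_inj.
- move=> z w Iz; rewrite {1}(row_sum_delta w) pd_lin; last first.
    exact: smooth_on_differentiable sF Iz.
  by rewrite dot_sumr big1// => l _; rewrite dotZr [dot _ _]Ln// mulr0.
- move=> z v w Iz.
  have yE t : pd t (y \o cinv phi) z = c^-1 *: pd t (laplace_map x \o cinv phi) z.
    rewrite !pdE; apply: deriveZ.
    exact: smooth_on_derivable (smooth_laplace hx Aphi) Iz.
  have LmE t : pd t (laplace_map x \o cinv phi) z =
      mdiff (laplace_map x) phi (cinv phi z) t.
    apply/esym/mdiff_pd; first exact: Iz.
    exact: smooth_on_differentiable (smooth_laplace hx Aphi) Iz.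
  have iE : induced_metric x phi (cinv phi z) v w =
      dot (pd v (x \o cinv phi) z) (pd w (x \o cinv phi) z).
    by rewrite /induced_metric !mdiff_chart.
  rewrite !yE !LmE dotZl dotZr (hc v w Aphi (cinv_dom Iz)) iE.
  by field; exact: cn0.
- move=> z Iz; have := @lapv_dot R 3 4 (x \o cinv phi) z (y (cinv phi z)).
  move=> H; rewrite -[LHS]opprK -H => [|l]; last by rewrite dotC Ln.
  have -> : lapv (x \o cinv phi) z = c *: y (cinv phi z).
    by rewrite (LE _ Iz) scalerA (mulfV cn0) scale1r.
  by rewrite dotZl.
Qed.

Lemma homothetic_center : exists a : 'rV[R]_4, forall p, y p = x p - a.
Proof.
pose D p := y p - x p.
have locD p : \forall q \near p, D q = D p.
  have Aphi := chart_at_atlas p; have Dp := chart_at_dom p.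
  move: (chart_at p) Aphi Dp => phi Aphi Dp.
  have oI := @cimg_open _ _ _ phi.
  have : nbhs (cmap phi p) (img phi).
    by apply: open_nbhs_nbhs; split => //; exact: cmap_img.
  move=> /nbhs_ballP[e /= e0 eI].
  have dy z : img phi z -> differentiable (y \o cinv phi) z.
    by apply: smooth_on_differentiable; exact: smooth_y.
  have dx z : img phi z -> differentiable (x \o cinv phi) z.
    by apply: smooth_on_differentiable; exact: smooth_chart.
  have DE z v : img phi z -> 'D_v (D \o cinv phi) z = 0.
    move=> Iz; apply: etrans (deriveB (smooth_on_derivable (smooth_y Aphi) Iz)
      (smooth_on_derivable (smooth_chart hx Aphi) Iz)) _.
    have [H _] := homothetic_local Aphi Iz.
    by have := H v; rewrite !pdE => ->; rewrite subrr.
  have := @locally_cst R 3 4 (D \o cinv phi) (cmap phi p) e.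
  move=> H; apply: filterS (nbhs_cmap Dp (nbhsx_ballx (cmap phi p) e e0)).
  move=> q [Dq Bq]; have := H _ _ _ Bq; rewrite /= !cmapK//; apply.
    by move=> z /eI Iz; apply: differentiableB; [exact: dy|exact: dx].
  by move=> z v /eI Iz; exact: DE.
(* Connectedness does not exclude the empty manifold, where any centre will do. *)
have [[p]|nM] := pselect (exists p : M, True).
  exists (- D p) => q; rewrite opprK -(locally_constant_connected hM locD p q).
  by rewrite /D addrC subrK.
by exists 0 => p; exfalso; apply: nM; exists p.
Qed.

Lemma homothetic_sphere : open_portion_of_hypersphere (range x).
Proof.
have [a ya] := homothetic_center; pose r := Num.sqrt (3 / c).
have r0 : 0 < r by rewrite sqrtr_gt0 divr_gt0.
have r2 : r ^+ 2 = 3 / c by rewrite sqr_sqrtr// divr_ge0// ltW.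
have sph p : hypersphere a r (x p).
  have [_] := homothetic_local (chart_at_atlas p) (cmap_img (chart_at_dom p)).
  rewrite cmapK; last exact: chart_at_dom.
  by rewrite /hypersphere /= -ya r2 => <-; rewrite mulrAC divff// mul1r.
exists a, r; split=> //.
(* The largest open set that meets the sphere only in points of the image; it remains to see that it
   contains every point of the image. *)
pose O := \bigcup_(V in [set V | open V /\ V `&` hypersphere a r `<=` range x]) V.
exists O; first by apply: bigcup_open => V [].
apply/seteqP; split=> [_ [p _ <-]|z [[V [oV VP] Vz] Sz]]; last exact: VP.
split=> //.
have Aphi := chart_at_atlas p; have Dp := chart_at_dom p.
move: (chart_at p) Aphi Dp => phi Aphi Dp.
have [d d0 dP] := @sphere_image R 3 (img phi) (x \o cinv phi) a r
  (@cimg_open _ _ _ phi) (smooth_chart hx Aphi)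
  (fun u w Iu => @pd_chart_inj _ _ _ _ _ hx phi u w Aphi Iu) r0
  (fun u _ => sph (cinv phi u)) _ (cmap_img Dp).
pose V := [set z : 'rV[R]_4 | dot (x p - z) (x p - z) < d].
exists V; last by rewrite /V /= subrr dot0l.
split=> [|z [Vz Sz]].
  have -> : V = (fun z => dot (z - x p) (z - x p)) @^-1` [set t | t < d].
    by apply/seteqP; split=> z; rewrite /V /= -opprB dotNl dotNr opprK.
  apply: open_comp; last exact: open_lt.
  move=> z _; have sid : smooth_on setT (fun z : 'rV[R]_4 => z - x p).
    by apply: smooth_on_subc; [exact: openT|exact/smooth_on_id/openT].
  have [dsq _] := Ck_dot 1 (@openT _) sid sid.
  exact/differentiable_continuous/dsq.
have [|u Iu <-] := dP z Sz; first by rewrite /= cmapK.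
by exists (cinv phi u).
Qed.

End forward.

Section backward.
Variables (R : realType) (M : smooth_manifold R 3) (x : M -> 'rV[R]_4).
Variables (a : 'rV[R]_4) (r : R).
Hypothesis hx : immersion x.
Hypothesis r_gt0 : 0 < r.
Hypothesis sph : forall p, hypersphere a r (x p).

(** The Laplace map is [x - a] times 3 / r^2, by [lapv_sphere] with [k = 3]; this is also the
    homothety factor. *)
Lemma sphere_homothetic : homothetic x (laplace_map x).
Proof.
have k0 : 0 < 3 / r ^+ 2 by rewrite divr_gt0// exprn_gt0.
have LE p : laplace_map x p = (3 / r ^+ 2) *: (x p - a).
  rewrite laplace_map_chart_at//.
  have Aphi := chart_at_atlas p; have Dp := chart_at_dom p.
  rewrite (@lapv_sphere R 3 (cmap (chart_at p) @` cdom (chart_at p))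
    (x \o cinv (chart_at p)) a r).
  - by rewrite /= cmapK.
  - exact: cimg_open.
  - exact: smooth_chart.
  - by move=> u w; exact: pd_chart_inj.
  - by [].
  - by move=> u _; exact: sph.
  - exact: cmap_img.
exists (3 / r ^+ 2) => // phi p v w Aphi Dp.
have dF : differentiable (x \o cinv phi) (cmap phi p).
  exact: smooth_on_differentiable (smooth_chart hx Aphi) (cmap_img Dp).
have dE t : mdiff (laplace_map x) phi p t = (3 / r ^+ 2) *: mdiff x phi p t.
  have fE : laplace_map x \o cinv phi = (3 / r ^+ 2) *: ((x \o cinv phi) - cst a).
    by apply/funext => u; exact: LE.
  have dFa : differentiable (x \o cinv phi - cst a) (cmap phi p).
    by apply: differentiableB => //; exact: differentiable_cst.
  rewrite /mdiff fE.
  apply: etrans (esym (deriveE t (differentiableZ _ dFa))) _.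
  apply: etrans (deriveZ _ (diff_derivable dFa)) _; congr (_ *: _).
  apply: etrans (deriveB (diff_derivable dF) (derivable_cst a _ t)) _.
  by rewrite derive_cst subr0; exact: deriveE.
by rewrite !dE dotZl dotZr mulrA -expr2.
Qed.

End backward.

Theorem theorem2p5 (R : realType) (M : smooth_manifold R 3)
    (x : M -> 'rV[R]_4)
    (hM : connected [set: M])
    (hx : immersion x) :
  homothetic x (laplace_map x) <-> open_portion_of_hypersphere (range x).
Proof.
split=> [[c c0 hc]|[a [r [r0 [W oW xW]]]]].
  exact: homothetic_sphere hM hx c0 hc.
apply: (@sphere_homothetic R M x a r hx r0) => p.
have : range x (x p) by exists p.
by rewrite xW; case.
Qed.
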